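(* Let $M^*\in\mathbb R^{d_1\times d_2}$ with $r=\mathrm{rank}(M^* )$, let $\alpha\in(0,1)$, and let $\pi_{n,\alpha}$ be the fractional posterior built from the spectral scaled Student prior $\pi_{st}$ with parameter $\tau=1/n$. Then $$\mathbb P\left[\int D_\alpha(P_M,P_{M^*})\,\pi_{n,\alpha}(\mathrm dM)\le\frac{2(\alpha+1)}{1-\alpha}\,\varepsilon_n\right]\ge 1-\frac{2}{n\varepsilon_n},$$ where $$\varepsilon_n=\frac{2r(d_1+d_2+2)\log\left(1+\frac{n\|M^*\|_F}{\sqrt{2r}}\right)}{n},$$ with the convention $0\log(1+0/0)=0$ when $r=0$ and $M^*=0$.
   Context: Model (1-bit matrix completion). Let $f(x)=e^x/(1+e^x)$ and let $\Pi$ be a fixed probability distribution on $[d_1]\times[d_2]$, where $[m]=\{1,\dots,m\}$. For $M\in\mathbb R^{d_1\times d_2}$, $P_M$ denotes the joint distribution of a pair $(\omega,Y)\in([d_1]\times[d_2])\times\{-1,+1\}$ with $\omega\sim\Pi$ and, given $\omega$, $Y=1$ with probability $f(M_\omega)$ and $Y=-1$ with probability $1-f(M_\omega)$. The data $(\omega_1,Y_1),\dots,(\omega_n,Y_n)$ are i.i.d. from $P_{M^*}$; $\mathbb E$ and $\mathbb P$ refer to the law of this sample. Fractional posterior. The likelihood is $L_n(M)=\prod_{s=1}^n f(M_{\omega_s})^{\mathbf 1[Y_s=1]}(1-f(M_{\omega_s}))^{\mathbf 1[Y_s=-1]}$. For $\alpha\in(0,1)$ and a prior $\pi$ on matrices,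 $\pi_{n,\alpha}(\mathrm dM)\propto L_n(M)^\alpha\,\pi(\mathrm dM)$. Spectral scaled Student prior. For $\tau>0$, $\pi_{st}$ is the probability distribution on $\mathbb R^{d_1\times d_2}$ with Lebesgue density $\pi_{st}(M)\propto\det(\tau^2\mathbf I_{d_1}+MM^\top)^{-(d_1+d_2+2)/2}$. Rényi divergence. For $\alpha\in(0,1)$, $D_\alpha(Q,R)=\frac1{\alpha-1}\log\int\left(\frac{\mathrm dQ}{\mathrm d\mu}\right)^\alpha\left(\frac{\mathrm dR}{\mathrm d\mu}\right)^{1-\alpha}\mathrm d\mu$ for any $\mu$ dominating $Q$ and $R$. $\|\cdot\|_F$ is the Frobenius norm. *)

(* Defs.v *)
From HB Require Import structures.
From mathcomp Require Import all_boot all_order all_algebra perm.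
From mathcomp Require Import all_classical all_reals all_analysis.
From mathcomp Require Import measurable_realfun bernoulli_distribution.

Set Implicit Arguments.
Unset Strict Implicit.
Unset Printing Implicit Defensive.

Import Order.TTheory GRing.Theory Num.Theory.
Import numFieldNormedType.Exports.

Local Open Scope classical_set_scope.
Local Open Scope ring_scope.

(* Every subset of 'I_n.+1 is measurable. The successor is there because a
   measurableType has to be pointed. *)
HB.instance Definition _ (n : nat) := isPointed.Build 'I_n.+1 ord0.

HB.instance Definition _ (n : nat) := @isMeasurable.Build
  default_measure_display 'I_n.+1 discrete_measurable
  (@discrete_measurable0 _) (@discrete_measurableC _)
  (@discrete_measurableU _).

Section lebesgue_tuple.
Context {R : realType}.

Definition tcons n (p : R * n.-tuple R) : n.+1.-tuple R := [tuple of p.1 :: p.2].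

Lemma measurable_tcons n : measurable_fun [set: R * n.-tuple R] (@tcons n).
Proof. by apply: measurable_cons; [exact: measurable_fst|exact: measurable_snd]. Qed.

Section step.
Variables (n : nat) (m : {sigma_finite_measure set (n.-tuple R) -> \bar R}).

Definition lebesgue_step : set (n.+1.-tuple R) -> \bar R :=
  fun A => (@lebesgue_measure R \x m)%E (@tcons n @^-1` A).

Let mpre A : measurable A -> measurable (@tcons n @^-1` A).
Proof. by move=> mA; rewrite -[X in measurable X]setTI; exact: measurable_tcons. Qed.

Let step0 : lebesgue_step set0 = 0%E.
Proof. by rewrite /lebesgue_step preimage_set0 measure0. Qed.

Let step_ge0 A : (0 <= lebesgue_step A)%E.
Proof. exact: measure_ge0. Qed.

Let step_sigma_additive : semi_sigma_additive lebesgue_step.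
Proof.
move=> F mF tF mUF; rewrite /lebesgue_step preimage_bigcup.
apply: measure_semi_sigma_additive.
- by move=> k; exact: mpre.
- apply/trivIsetP => /= i j _ _ ij; rewrite -preimage_setI.
  by move/trivIsetP : tF => /(_ _ _ _ _ ij) ->//; rewrite preimage_set0.
- by rewrite -preimage_bigcup; exact: mpre.
Qed.

HB.instance Definition _ := isMeasure.Build _ _ _
  lebesgue_step step0 step_ge0 step_sigma_additive.

Let step_sigma_finite : sigma_finite setT lebesgue_step.
Proof.
have /sigma_finiteP[F [TF ndF Foo]] := sigma_finiteT (@lebesgue_measure R).
have /sigma_finiteP[G [TG ndG Goo]] := sigma_finiteT m.
pose g (t : n.+1.-tuple R) : R * n.-tuple R := (thead t, [tuple of behead t]).
have mg : measurable_fun setT g.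
  apply/measurable_fun_pairP; split; first exact: measurable_tnth.
  exact: measurable_behead.
have gK : cancel (@tcons n) g.
  by move=> [x t]; rewrite /g /tcons theadE; congr pair; exact/val_inj.
exists (fun k => g @^-1` (F k `*` G k)).
  apply/esym; rewrite -subTset => t _.
  have [i _ Fi] : (\bigcup_k F k) (g t).1 by rewrite -TF.
  have [j _ Gj] : (\bigcup_k G k) (g t).2 by rewrite -TG.
  exists (maxn i j) => //; split.
  - by move: Fi; exact/subsetPset/ndF/leq_maxl.
  - by move: Gj; exact/subsetPset/ndG/leq_maxr.
move=> k; have [mF Fky] := Foo k; have [mG Gky] := Goo k; split.
  by rewrite -[X in measurable X]setTI; apply: mg => //; exact: measurableX.
rewrite /lebesgue_step -comp_preimage (_ : g \o @tcons n = id); last first.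
  by apply/funext => p /=; rewrite gK.
by rewrite preimage_id product_measure1E// lte_mul_pinfty// ge0_fin_numE.
Qed.

HB.instance Definition _ := Measure_isSigmaFinite.Build _ _ _
  lebesgue_step step_sigma_finite.

End step.

Fixpoint lebesgue_tuple (n : nat) :
    {sigma_finite_measure set (n.-tuple R) -> \bar R} :=
  match n with
  | 0 => \d_([tuple] : 0.-tuple R)
  | k.+1 => lebesgue_step (lebesgue_tuple k)
  end.

Lemma lebesgue_tuple_box n (A : 'I_n -> set R) :
    (forall i, measurable (A i)) ->
  lebesgue_tuple n [set t | forall i, A i (tnth t i)] =
  (\prod_(i < n) @lebesgue_measure R (A i))%E.
Proof.
elim: n A => [|n IH] A mA.
  rewrite big_ord0 /= diracE mem_set//.
  by case.
rewrite big_ord_recl /= /lebesgue_step.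
rewrite -IH; last by move=> i; exact: mA.
rewrite -product_measure1E//; last first.
  rewrite (_ : [set t | _] = \bigcap_(i in [set: 'I_n])
      (@tnth n R ^~ i @^-1` A (lift ord0 i))); last first.
    by apply/seteqP; split => t /= H i => [_|]; exact: H.
  apply: fin_bigcap_measurable; first exact: finite_finset.
  by move=> i _; rewrite -[X in measurable X]setTI; exact: measurable_tnth.
  exact: mA.
congr (product_measure1 _ _ _).
apply/seteqP; split => -[x t] /=.
  move=> H; split; first exact: (H ord0).
  by move=> i; have := H (lift ord0 i); rewrite tnthS.
move=> [Ax H] i; case: (unliftP ord0 i) => [j ->|->] //.
by rewrite tnthS; exact: H.
Qed.

End lebesgue_tuple.

Section matrix_measure.
Context {R : realType} {m n : nat}.

Definition mx_of_tuple (t : (m * n).-tuple R) : 'M[R]_(m, n) :=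
  \matrix_(i, j) tnth t (mxvec_index i j).

Definition tuple_of_mx (M : 'M[R]_(m, n)) : (m * n).-tuple R :=
  [tuple mxvec M 0 k | k < m * n].

Lemma mx_of_tupleK : cancel mx_of_tuple tuple_of_mx.
Proof.
move=> t; apply: eq_from_tnth => k; rewrite tnth_mktuple.
by case/mxvec_indexP: k => i j; rewrite mxvecE mxE.
Qed.

Lemma tuple_of_mxK : cancel tuple_of_mx mx_of_tuple.
Proof. by move=> M; apply/matrixP => i j; rewrite mxE tnth_mktuple mxvecE. Qed.

(* The product sigma-algebra of R^(m * n), transported along the bijection
   [mx_of_tuple], which reads the entries row by row. *)
Definition measurable_mx : set (set 'M[R]_(m, n)) :=
  [set A | measurable (mx_of_tuple @^-1` A)].

Let measurable_mx0 : measurable_mx set0.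
Proof. by rewrite /measurable_mx /= preimage_set0. Qed.

Let measurable_mxC A : measurable_mx A -> measurable_mx (~` A).
Proof. by rewrite /measurable_mx /= -preimage_setC => /measurableC. Qed.

Let measurable_mxU (F : (set 'M[R]_(m, n))^nat) :
  (forall i, measurable_mx (F i)) -> measurable_mx (\bigcup_i F i).
Proof.
by rewrite /measurable_mx /= preimage_bigcup => mF; apply: bigcup_measurable.
Qed.

HB.instance Definition _ := @isMeasurable.Build default_measure_display
  'M[R]_(m, n) measurable_mx measurable_mx0 measurable_mxC measurable_mxU.

Lemma measurable_entry i j :
  measurable_fun [set: 'M[R]_(m, n)] (fun M => M i j).
Proof.
move=> _ B mB; rewrite setTI /measurable /= /measurable_mx /=.
rewrite (_ : _ @^-1` _ = @tnth _ R ^~ (mxvec_index i j) @^-1` B).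
  by rewrite -[X in measurable X]setTI; exact: measurable_tnth.
by apply/seteqP; split => t /=; rewrite mxE.
Qed.

Definition lebesgue_mx : set 'M[R]_(m, n) -> \bar R :=
  fun A => lebesgue_tuple (m * n) (mx_of_tuple @^-1` A).

Let lebesgue_mx0 : lebesgue_mx set0 = 0%E.
Proof. by rewrite /lebesgue_mx preimage_set0 measure0. Qed.

Let lebesgue_mx_ge0 A : (0 <= lebesgue_mx A)%E.
Proof. exact: measure_ge0. Qed.

Let lebesgue_mx_sigma_additive : semi_sigma_additive lebesgue_mx.
Proof.
move=> F mF tF mUF; rewrite /lebesgue_mx preimage_bigcup.
apply: measure_semi_sigma_additive.
- by move=> k; exact: mF.
- apply/trivIsetP => /= i j _ _ ij; rewrite -preimage_setI.
  by move/trivIsetP : tF => /(_ _ _ _ _ ij) ->//; rewrite preimage_set0.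
- by rewrite -preimage_bigcup; exact: mUF.
Qed.

HB.instance Definition _ := isMeasure.Build _ _ _
  lebesgue_mx lebesgue_mx0 lebesgue_mx_ge0 lebesgue_mx_sigma_additive.

Lemma lebesgue_mx_box (A : 'I_m -> 'I_n -> set R) :
    (forall i j, measurable (A i j)) ->
  lebesgue_mx [set M | forall i j, A i j (M i j)] =
  (\prod_(i < m) \prod_(j < n) @lebesgue_measure R (A i j))%E.
Proof.
move=> mA; rewrite pair_bigA /= /lebesgue_mx.
have [f fK Kf] := curry_mxvec_bij m n.
pose B k : set R := A (f k).1 (f k).2.
have BE i j : B (mxvec_index i j) = A i j.
  by rewrite /B -[mxvec_index i j]/(uncurry (@mxvec_index m n) (i, j)) fK.
transitivity (\prod_(k < m * n) @lebesgue_measure R (B k))%E; last first.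
  rewrite (reindex _ (curry_mxvec_bij m n)) /=.
  by apply: eq_bigr => -[i j] _ /=; rewrite BE.
rewrite -lebesgue_tuple_box; last by move=> k; exact: mA.
congr (lebesgue_tuple _ _); apply/seteqP; split => t /= H.
  by move=> k; case/mxvec_indexP: k => i j; rewrite BE; have := H i j; rewrite mxE.
by move=> i j; rewrite mxE -BE; exact: H.
Qed.

End matrix_measure.

Section density_measure.
Local Open Scope ereal_scope.
Context d (T : measurableType d) (R : realType).
Variables (mu : {measure set T -> \bar R}) (w : T -> R).
Hypotheses (w0 : forall x, (0 <= w x)%R) (mw : measurable_fun [set: T] w).

(* The proofs are arguments so that the measure structure can be inferred. *)
Definition density_measure of (forall x, (0 <= w x)%R) & measurable_fun [set: T] w
  : set T -> \bar R := fun A => \int[mu]_(x in A) (w x)%:E.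

Local Notation nu := (density_measure w0 mw).

Let nu0 : nu set0 = 0.
Proof. exact: integral_set0. Qed.

Let nu_ge0 A : 0 <= nu A.
Proof. by apply: integral_ge0 => x _; rewrite lee_fin. Qed.

Let nu_sigma_additive : semi_sigma_additive nu.
Proof.
move=> F mF tF mUF; rewrite /density_measure; apply: cvg_toP.
  apply: ereal_nondecreasing_is_cvgn => k l kl.
  apply: lee_sum_nneg_natr => // i _ _.
  by apply: integral_ge0 => x _; rewrite lee_fin.
rewrite ge0_integral_bigcup//=.
- by apply: measurable_funTS; apply: measurableT_comp.
- by move=> x _; rewrite lee_fin.
Qed.

HB.instance Definition _ := isMeasure.Build _ _ _ nu nu0 nu_ge0 nu_sigma_additive.

End density_measure.

Section renyi.
Local Open Scope ereal_scope.
Local Open Scope charge_scope.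
Context d (T : measurableType d) (R : realType).
Variables Q P : probability T R.

Definition sum_measure := measure_add Q P.

HB.instance Definition _ := Measure.on sum_measure.

Let sum_measure_fin : fin_num_fun sum_measure.
Proof.
by move=> A mA; rewrite /sum_measure measure_addE fin_numD !fin_num_measure.
Qed.

HB.instance Definition _ := Measure_isFinite.Build _ _ _ sum_measure sum_measure_fin.

Lemma dominates_sum_measurel : charge_of_finite_measure Q `<< sum_measure.
Proof.
apply/null_content_dominatesP => A mA; rewrite /= /sum_measure measure_addE => /eqP.
by rewrite padde_eq0 // => /andP[/eqP].
Qed.

Lemma dominates_sum_measurer : charge_of_finite_measure P `<< sum_measure.
Proof.
apply/null_content_dominatesP => A mA; rewrite /= /sum_measure measure_addE => /eqP.
by rewrite padde_eq0 // => /andP[_ /eqP].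
Qed.

Local Notation q := ('d (charge_of_finite_measure Q) '/d sum_measure).
Local Notation p := ('d (charge_of_finite_measure P) '/d sum_measure).

(* The value does not depend on the dominating measure; Q + P is one. *)
Definition renyi_divergence (alpha : R) : \bar R :=
  ((alpha - 1)^-1)%:E * lne (\int[sum_measure]_x (q x `^ alpha * p x `^ (1 - alpha))).

End renyi.

Section iid.
Context d d' (T : measurableType d) (T' : measurableType d') (R : realType).
Variables (P : probability T R) (n : nat) (X : 'I_n -> {RV P >-> T'}).

Definition mutually_independent :=
  forall (J : {set 'I_n}) (A : 'I_n -> set T'), (forall i, measurable (A i)) ->
  P (\bigcap_(i in [set` J]) (X i @^-1` A i)) =
  (\prod_(i in J) P (X i @^-1` A i))%E.

Definition iid (Q : probability T' R) :=
  mutually_independent /\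
  forall (i : 'I_n) A, measurable A -> distribution P (X i) A = Q A.

End iid.

Section one_bit.
Context {R : realType} {d1 d2 : nat}.
Local Notation mat := 'M[R]_(d1.+1, d2.+1).
Local Notation entry := ('I_d1.+1 * 'I_d2.+1)%type.

Definition logistic (x : R) : R := expR x / (1 + expR x).

(* An observation (omega, Y), where Y = +1 is encoded by true and Y = -1 by
   false. *)
Local Notation obs := (entry * bool)%type.

Section law.
Variables (Pi : probability entry R) (M : mat).

Definition obs_law : set obs -> \bar R := fun A =>
  (\int[Pi]_w bernoulli_prob (logistic (M w.1 w.2)) (xsection A w))%E.

Let obs_law0 : obs_law set0 = 0%E.
Proof. by apply: integral0_eq => w _; rewrite xsection0 measure0. Qed.

Let obs_law_ge0 A : (0 <= obs_law A)%E.
Proof. by apply: integral_ge0 => w _; exact: measure_ge0. Qed.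

Lemma measurable_entry_set (A : set entry) : measurable A.
Proof.
rewrite (_ : A = \bigcup_(w in A) [set w]); last first.
  by apply/seteqP; split => [w Aw|w [v Av ->]] //; exists w.
apply: fin_bigcup_measurable; first exact: finite_finset.
move=> [i j] _; rewrite (_ : [set _] = [set i] `*` [set j]); last first.
  by apply/seteqP; split => [[a b] [-> ->]|[a b] /= [-> ->]].
exact: measurableX.
Qed.

Let obs_law_sigma_additive : semi_sigma_additive obs_law.
Proof.
move=> F mF tF mUF; apply: cvg_toP.
  apply: ereal_nondecreasing_is_cvgn => k l kl.
  by apply: lee_sum_nneg_natr => // i _ _; exact: obs_law_ge0.
rewrite /obs_law -integral_nneseries//; last first.
  by move=> i _ B mB; exact: measurable_entry_set.
apply: eq_integral => w _; apply/cvg_lim => //=; rewrite xsection_bigcup.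
apply: (measure_sigma_additive _ (trivIset_xsection tF)) => i.
exact: measurable_xsection.
Qed.

HB.instance Definition _ := isMeasure.Build _ _ _ obs_law
  obs_law0 obs_law_ge0 obs_law_sigma_additive.

Let obs_law_setT : obs_law setT = 1%E.
Proof.
rewrite /obs_law; under eq_integral => w _.
  rewrite (_ : xsection _ _ = setT) ?probability_setT; last first.
    by apply/seteqP; split => b // _; rewrite /xsection /= in_setT.
  over.
by rewrite integral_cst//= mul1e probability_setT.
Qed.

HB.instance Definition _ := Measure_isProbability.Build _ _ _ obs_law obs_law_setT.

End law.

Definition frobenius_norm (M : mat) : R := Num.sqrt (\sum_i \sum_j M i j ^+ 2).

Definition student_weight (tau : R) (M : mat) : R :=
  \det ((tau ^+ 2)%:M + M *m M^T) `^ (- ((d1.+1 + d2.+1 + 2)%:R / 2)).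

Definition likelihood n (z : 'I_n -> obs) (M : mat) : R :=
  \prod_(s < n) (logistic (M (z s).1.1 (z s).1.2) ^+ (z s).2 *
                 (1 - logistic (M (z s).1.1 (z s).1.2)) ^+ (~~ (z s).2)).

Lemma student_weight_ge0 tau M : 0 <= student_weight tau M.
Proof. exact: powR_ge0. Qed.

Lemma measurable_student_weight tau :
  measurable_fun [set: mat] (student_weight tau).
Proof.
apply: (measurableT_comp (measurable_powR _)).
rewrite /determinant; apply: measurable_sum => s.
apply: measurable_funM; first exact: measurable_cst.
apply: measurable_prod => i _.
rewrite (_ : (fun _ => _) = fun M : mat =>
    ((tau ^+ 2)%:M : 'M[R]_d1.+1) i (s i) + \sum_k M i k * M (s i) k); last first.
  apply/funext => M; rewrite !mxE; congr (_ + _).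
  by apply: eq_bigr => k _; rewrite mxE.
apply: measurable_funD => //; apply: measurable_sum => k.
by apply: measurable_funM; exact: measurable_entry.
Qed.

Lemma logistic_gt0 x : 0 < logistic x.
Proof. by rewrite divr_gt0 ?addr_gt0 ?expR_gt0. Qed.

Lemma onem_logistic x : 1 - logistic x = (1 + expR x)^-1.
Proof.
have e0 : 1 + expR x != 0 by rewrite gt_eqF // addr_gt0 ?expR_gt0.
by rewrite /logistic -{1}(divff e0) -mulrBl addrK mul1r.
Qed.

Lemma likelihood_ge0 n (z : 'I_n -> obs) M : 0 <= likelihood z M.
Proof.
apply: prodr_ge0 => s _; rewrite mulr_ge0 ?exprn_ge0 ?(ltW (logistic_gt0 _))//.
by rewrite onem_logistic invr_ge0 addr_ge0 ?expR_ge0.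
Qed.

Lemma measurable_logistic : measurable_fun [set: R] logistic.
Proof.
rewrite (_ : logistic = fun x => 1 - (1 + expR x)^-1); last first.
  by apply/funext => x; rewrite -onem_logistic subKr.
apply: measurable_funB => //; apply: continuous_measurable_fun => x.
apply: cvgV; first by rewrite gt_eqF // addr_gt0 ?expR_gt0.
by apply: cvgD; [exact: cvg_cst|exact: continuous_expR].
Qed.

Lemma measurable_likelihood n (z : 'I_n -> obs) :
  measurable_fun [set: mat] (likelihood z).
Proof.
apply: measurable_prod => s _.
have mf : measurable_fun [set: mat]
    (fun M => logistic (M (z s).1.1 (z s).1.2)).
  apply: (measurableT_comp measurable_logistic).
  exact: measurable_entry.
apply: measurable_funM; apply: measurable_funX => //.
exact: measurable_funB.
Qed.

(* [mnormalize] divides by the total mass; its last argument is only used when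
   that mass is 0 or infinite. *)
Definition student_prior (tau : R) : probability mat R :=
  mnormalize (density_measure (@lebesgue_mx R d1.+1 d2.+1)
    (student_weight_ge0 tau) (measurable_student_weight tau)) \d_(0 : mat).

Section posterior.
Variables (alpha : R) (prior : probability mat R).
Variables (n : nat) (z : 'I_n -> obs).

Let frac_ge0 M : 0 <= likelihood z M `^ alpha.
Proof. exact: powR_ge0. Qed.

Let measurable_frac : measurable_fun [set: mat] (fun M => likelihood z M `^ alpha).
Proof.
by apply: (measurableT_comp (measurable_powR _)); exact: measurable_likelihood.
Qed.

Definition fractional_posterior : probability mat R :=
  mnormalize (density_measure prior frac_ge0 measurable_frac) prior.

End posterior.

(* When \rank M = 0, M = 0 and the quotient by sqrt 0 = 0 is 0. *)
Definition rate (n : nat) (M : mat) : R :=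
  let r : R := (\rank M)%:R in
  2 * r * (d1.+1 + d2.+1 + 2)%:R *
  ln (1 + n%:R * frobenius_norm M / Num.sqrt (2 * r)) / n%:R.

End one_bit.

(* Main.v *)
Require Import Defs.
From HB Require Import structures.
From mathcomp Require Import all_boot all_order all_algebra.
From mathcomp Require Import all_classical all_reals all_analysis.
From mathcomp Require Import measurable_realfun.
From mathcomp Require Import perm bernoulli_distribution ring lra.

Set Implicit Arguments.
Unset Strict Implicit.
Unset Printing Implicit Defensive.

Import Order.TTheory GRing.Theory Num.Theory.
Import numFieldNormedType.Exports.

Local Open Scope classical_set_scope.
Local Open Scope ring_scope.

(* The fractional posterior is compared with the prior translated by Mstar.

   Determinant: write D(M) = det(tau^2 I + M M^T) and let r be the rank of
   Mstar. Peeling Mstar off one direction of its row space at a time gives the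
   pointwise bound D(N + Mstar) <= (1 + |Mstar|_F / (tau sqrt (2 r)))^(4 r) D(N),
   so that with tau = 1 / n the prior density at N + Mstar is at least
   exp(- n eps_n) times the density at N.

   First moment: integrating out the entries of M one at a time, by completing
   squares, shows that a single entry of M has density proportional to
   (tau^2 + x^2)^(-2) under the prior, hence E|M_ij| <= 4 tau. As log f and
   log (1 - f) are 1-Lipschitz, the log-likelihood ratio along the translated
   prior is at most 4 on average, whatever the sample. The evidence is therefore
   at least exp(- n eps_n - 4 alpha) L_n(Mstar)^alpha for every sample, and no
   concentration of the log-likelihood ratio is needed.

   Renyi divergence: E int exp(- alpha r_n(M) + n (1 - alpha) D_alpha(P_M, P_Mstar))
   dpi = 1, where r_n is the log-likelihood ratio, because the integrand has
   expectation one for each M. Markov's inequality and Jensen's inequality for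
   the posterior conclude. The probability bound is vacuous unless
   n eps_n > 2. *)

(** * Determinants of Gram matrices *)

Section gram_determinant.
Context {R : rcfType}.

(** The squared Frobenius norm. As a trace it lets orthogonal splittings be checked by matrix
    algebra. *)
Definition sqnorm m n (A : 'M[R]_(m, n)) : R := \tr (A *m A^T).

(** The matrix in the prior density, with [t] in the role of tau^2. *)
Definition gram m n (t : R) (M : 'M[R]_(m, n)) : 'M[R]_m := t%:M + M *m M^T.

Let trmxD m n (A B : 'M[R]_(m, n)) : (A + B)^T = A^T + B^T.
Proof. exact: linearD. Qed.

Let trmxB m n (A B : 'M[R]_(m, n)) : (A - B)^T = A^T - B^T.
Proof. exact: linearB. Qed.

Let trmxZ m n a (A : 'M[R]_(m, n)) : (a *: A)^T = a *: A^T.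
Proof. exact: linearZ. Qed.

Lemma sqnormE m n (A : 'M[R]_(m, n)) : sqnorm A = \sum_i \sum_j A i j ^+ 2.
Proof.
apply: eq_bigr => i _; rewrite mxE; apply: eq_bigr => j _.
by rewrite mxE expr2.
Qed.

Lemma sqnorm_ge0 m n (A : 'M[R]_(m, n)) : 0 <= sqnorm A.
Proof.
by rewrite sqnormE; apply: sumr_ge0 => i _; apply: sumr_ge0 => j _; exact: sqr_ge0.
Qed.

Lemma sqnorm_eq0 m n (A : 'M[R]_(m, n)) : (sqnorm A == 0) = (A == 0).
Proof.
apply/idP/eqP => [|->]; last by rewrite /sqnorm mul0mx linear0.
rewrite sqnormE psumr_eq0; last by move=> i _; apply: sumr_ge0 => j _; exact: sqr_ge0.
move=> /allP Ai0; apply/matrixP => i j; rewrite mxE.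
have /implyP/(_ isT) := Ai0 i (mem_index_enum _).
rewrite psumr_eq0; last by move=> k _; exact: sqr_ge0.
by move=> /allP/(_ j (mem_index_enum _)); rewrite sqrf_eq0 => /eqP.
Qed.

Lemma sqnorm_col m (x : 'cV[R]_m) : sqnorm x = (x^T *m x) 0 0.
Proof. by rewrite /sqnorm mxtrace_mulC [LHS]trace_mx11. Qed.

Lemma sqnorm_row n (v : 'rV[R]_n) : sqnorm v = (v *m v^T) 0 0.
Proof. by rewrite /sqnorm [LHS]trace_mx11. Qed.

Lemma mul_colC m (x y : 'cV[R]_m) : (x^T *m y) 0 0 = (y^T *m x) 0 0.
Proof. by have /matrixP/(_ 0 0) := trmx_mul x^T y; rewrite trmxK mxE. Qed.

Lemma tr_gram m n t (M : 'M[R]_(m, n)) : (gram t M)^T = gram t M.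
Proof. by rewrite /gram trmxD tr_scalar_mx trmx_mul trmxK. Qed.

Lemma gram_row_mx m n1 n2 t (M : 'M[R]_(m, n1)) (N : 'M[R]_(m, n2)) :
  gram t (row_mx M N) = gram t N + M *m M^T.
Proof. by rewrite /gram tr_row_mx mul_row_col addrAC addrA. Qed.

(** The matrix determinant lemma, with the column written as [S *m y] so that no inverse of [S]
    appears. One block matrix is factored in two ways, with [L] on the left and with [L] on the
    right. *)
Lemma det_rank1_update n (S : 'M[R]_n) (y : 'cV_n) (v : 'rV_n) :
  \det (S + S *m y *m v) = \det S * (1 + (v *m y) 0 0).
Proof.
have -> : S + S *m y *m v = S *m (1%:M + y *m v) by rewrite mulmxDr mulmx1 mulmxA.
rewrite det_mulmx; congr (_ * _).
pose L : 'M[R]_(1 + n) := block_mx 1%:M 0 y 1%:M.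
have E1 : L *m block_mx 1%:M (- v) 0 (1%:M + y *m v) = block_mx 1%:M (- v) y 1%:M.
  rewrite /L mulmx_block !mul1mx !mul0mx !mulmx1 ?mulmx0 !addr0 mulmxN.
  by rewrite addrCA addNr addr0.
have E2 : block_mx (1%:M + v *m y) (- v) 0 1%:M *m L = block_mx 1%:M (- v) y 1%:M.
  rewrite /L mulmx_block !mul1mx !mul0mx !mulmx1 ?mulmx0 !add0r mulNmx.
  by rewrite addrK.
have := congr1 determinant (etrans E1 (esym E2)).
rewrite !det_mulmx /L det_lblock !det_ublock !det1 !mul1r !mulr1 => ->.
by rewrite det_mx11 !mxE.
Qed.

Lemma gram_form m n t (M : 'M[R]_(m, n)) (x : 'cV_m) :
  (x^T *m (gram t M *m x)) 0 0 = t * sqnorm x + sqnorm (M^T *m x).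
Proof.
rewrite /gram mulmxDl mulmxDr mul_scalar_mx -scalemxAr mxE.
congr (_ + _); first by rewrite mxE sqnorm_col.
by rewrite sqnorm_col trmx_mul trmxK !mulmxA.
Qed.

Lemma gram_form_ge0 m n t (M : 'M[R]_(m, n)) (x : 'cV_m) : 0 <= t ->
  0 <= (x^T *m (gram t M *m x)) 0 0.
Proof. by move=> t0; rewrite gram_form addr_ge0 ?mulr_ge0 ?sqnorm_ge0. Qed.

Lemma unitmx_solve m (S : 'M[R]_m) (u : 'cV_m) : \det S != 0 ->
  exists y, S *m y = u.
Proof.
rewrite -unitfE -unitmxE => uS; exists (invmx S *m u).
by rewrite mulmxA mulmxV // mul1mx.
Qed.

(** Induction on the columns: each one is a rank one update, which multiplies the determinant by 1
    plus the value at [y] of a nonnegative quadratic form. *)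
Lemma det_gram_gt0 m n t (M : 'M[R]_(m, n)) : 0 < t -> 0 < \det (gram t M).
Proof.
move=> t0; elim: n => [|n IH] in M *.
  by rewrite /gram thinmx0 mul0mx addr0 det_scalar exprn_gt0.
move: M; rewrite -[n.+1]/(1 + n)%N => M; rewrite -[M]hsubmxK gram_row_mx.
have [y yE] := unitmx_solve (lsubmx M) (lt0r_neq0 (IH (rsubmx M))).
rewrite -{1}yE det_rank1_update mulr_gt0 // ltr_pwDl // -yE trmx_mul tr_gram -mulmxA.
exact/gram_form_ge0/ltW.
Qed.

(** With G = [gram t M] and u = G z this reads t u^T G^-1 u <= |u|^2, which holds because G
    dominates t I. *)
Lemma gram_inv_form_le m n t (M : 'M[R]_(m, n)) (z : 'cV_m) : 0 < t ->
  t * (z^T *m (gram t M *m z)) 0 0 <= sqnorm (gram t M *m z).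
Proof.
move=> t0; rewrite gram_form.
have -> : gram t M *m z = t *: z + M *m (M^T *m z).
  by rewrite /gram mulmxDl mul_scalar_mx mulmxA.
set q := M^T *m z.
have -> : sqnorm (t *: z + M *m q) = t ^+ 2 * sqnorm z + 2 * t * sqnorm q + sqnorm (M *m q).
  rewrite !sqnorm_col trmxD trmxZ mulmxDl !mulmxDr.
  rewrite -!scalemxAl -!scalemxAr.
  have E (A B C D : 'M[R]_1) a :
      (a *: (a *: A) + a *: B + (a *: C + D)) 0 0 = a ^+ 2 * A 0 0 + a * (B 0 0 + C 0 0) + D 0 0.
    by rewrite !mxE; ring.
  rewrite E [((M *m q)^T *m z) _ _]mul_colC.
  have -> : (z^T *m (M *m q)) 0 0 = (q^T *m q) 0 0.
    by rewrite mulmxA /q -[z^T *m M]trmxK trmx_mul trmxK.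
  by ring.
have := sqnorm_ge0 (M *m q); have := sqnorm_ge0 q; nra.
Qed.

(** Removing from [M] its component along [v] leaves [Q]. With S = [gram t Q], both Gram matrices
    are S plus a rank one term, w w^T or (w + u)(w + u)^T. In the inner product given by S^-1, with
    W = <w, w>, V = <u, w> and U = <u, u>, the ratio of the determinants is (1 + W + 2 V + U) / (1 +
    W), where U <= s^2 and 2 V <= s W + s. *)
Lemma det_gram_rank1_le m n t s (M : 'M[R]_(m, n)) (u : 'cV_m) (v : 'rV_n) :
  0 < t -> 0 < s -> sqnorm v = 1 -> sqnorm u <= s ^+ 2 * t ->
  \det (gram t (M + u *m v)) <= (1 + s + s ^+ 2) * \det (gram t M).
Proof.
move=> t0 s0 v1 us.
have vv : v *m v^T = 1%:M by apply/matrixP => i j; rewrite !ord1 -sqnorm_row v1 mxE.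
pose Q := M - M *m v^T *m v.
pose w := M *m v^T.
have QQ : Q *m Q^T = M *m M^T - w *m w^T.
  rewrite /Q trmxB !trmx_mul trmxK mulmxBl !mulmxBr.
  rewrite -[M *m v^T *m v *m (v^T *m _)]mulmxA [v *m (v^T *m _)]mulmxA vv mul1mx.
  by rewrite !mulmxA subrr subr0.
have gM : gram t M = gram t Q + w *m w^T by rewrite /gram QQ addrA subrK.
have gMu : gram t (M + u *m v) = gram t Q + (w + u) *m (w + u)^T.
  rewrite /gram QQ -!addrA; congr (_ + _).
  rewrite !trmxD !trmx_mul !trmxK !mulmxDr !mulmxDl.
  rewrite -[u *m v *m (v^T *m u^T)]mulmxA [v *m (v^T *m u^T)]mulmxA vv mul1mx.
  by rewrite /w !mulmxA -!addrA addKr.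
have [y yE] := unitmx_solve w (lt0r_neq0 (det_gram_gt0 Q t0)).
have [z zE] := unitmx_solve u (lt0r_neq0 (det_gram_gt0 Q t0)).
rewrite gM gMu.
have detS (x x' : 'cV[R]_m) : gram t Q *m x' = x ->
    \det (gram t Q + x *m x^T) = \det (gram t Q) * (1 + (x^T *m x') 0 0).
  by move=> <-; exact: det_rank1_update.
rewrite (detS _ _ yE) (detS (w + u) (y + z)); last by rewrite mulmxDr yE zE.
rewrite mulrCA ler_pM2l ?det_gram_gt0 //.
set S := gram t Q in yE zE *.
have W0 : 0 <= (w^T *m y) 0 0.
  by rewrite -yE trmx_mul tr_gram -mulmxA; exact/gram_form_ge0/ltW.
have U0 : 0 <= (u^T *m z) 0 0.
  by rewrite -zE trmx_mul tr_gram -mulmxA; exact/gram_form_ge0/ltW.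
have Us : (u^T *m z) 0 0 <= s ^+ 2.
  rewrite -(ler_pM2l t0) mulrC [leRHS]mulrC; apply: le_trans us.
  rewrite mulrC mul_colC -zE; exact: gram_inv_form_le.
have wz : (w^T *m z) 0 0 = (u^T *m y) 0 0.
  by rewrite mul_colC -{1}yE -zE mulmxA trmx_mul tr_gram.
(* Nonnegativity of the form of [gram t Q] at [s *: y - z]: a Cauchy-Schwarz inequality weighted by
   [s]. *)
have X : 2 * s * (u^T *m y) 0 0 <= s ^+ 2 * (w^T *m y) 0 0 + (u^T *m z) 0 0.
  have := gram_form_ge0 Q (s *: y - z) (ltW t0).
  rewrite -/S mulmxBr -scalemxAr yE zE trmxB trmxZ mulmxBl !mulmxBr.
  rewrite -!scalemxAl -!scalemxAr.
  have E (A B C D : 'M[R]_1) :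
      (s *: (s *: A) - s *: B - (s *: C - D)) 0 0 = s ^+ 2 * A 0 0 - s * (B 0 0 + C 0 0) + D 0 0.
    by rewrite !mxE; ring.
  rewrite E [(y^T *m w) _ _]mul_colC [(y^T *m u) _ _]mul_colC.
  rewrite [(z^T *m w) _ _]mul_colC [(z^T *m u) _ _]mul_colC wz; nra.
have E (A B C D : 'M[R]_1) : (A + B + (C + D)) 0 0 = A 0 0 + B 0 0 + (C 0 0 + D 0 0).
  by rewrite !mxE.
rewrite trmxD mulmxDl !mulmxDr E wz.
set W := (w^T *m y) 0 0 in W0 X *; set U := (u^T *m z) 0 0 in U0 Us X *.
set V := (u^T *m y) 0 0 in X *.
have {}X : 2 * V <= s * W + s.
  rewrite -(ler_pM2l s0); nra.
nra.
Qed.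


Lemma det_gram_row_mx m n t (y : 'cV_m) (Q : 'M[R]_(m, n)) :
  \det (gram t (row_mx (gram t Q *m y) Q)) =
  \det (gram t Q) * (1 + ((gram t Q *m y)^T *m y) 0 0).
Proof. by rewrite gram_row_mx det_rank1_update. Qed.

(** The determinant is quadratic in its corner entry [x]. Completing the square gives the minimiser
    [b] and a minimum value made of three smaller determinants, which is what allows entries to be
    integrated out one at a time. *)
Lemma det_gram_block m n t (u : 'cV_m) (q : 'rV_n) (Q : 'M[R]_(m, n)) : 0 < t ->
  exists b, forall x : R,
  \det (gram t (row_mx (col_mx x%:M u) (col_mx q Q))) =
  \det (gram t Q) * (x - b) ^+ 2 +
  \det (gram t (col_mx q Q)) * \det (gram t (row_mx u Q)) / \det (gram t Q).
Proof.
move=> t0; have d0 := det_gram_gt0 Q t0.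
pose beta := Q *m q^T; pose a : 'M[R]_1 := t%:M + q *m q^T.
have SE : gram t (col_mx q Q) = block_mx a beta^T beta (gram t Q).
  rewrite /gram tr_col_mx mul_col_row (@scalar_mx_block _ 1 m) add_block_mx !add0r.
  by rewrite /beta trmx_mul trmxK.
have [y0 y0E] := unitmx_solve u (lt0r_neq0 d0).
have [e eE] := unitmx_solve beta (lt0r_neq0 d0).
(* The Schur complement of [gram t Q] in [gram t (col_mx q Q)], positive as a ratio of two Gram
   determinants. *)
pose sigma : R := (a - beta^T *m e) 0 0.
have sE : a - beta^T *m e = sigma%:M by rewrite [LHS]mx11_scalar.
have dS : \det (gram t (col_mx q Q)) = sigma * \det (gram t Q).
  have : \det (gram t (col_mx q Q) *m block_mx 1%:M 0 (- e) 1%:M) =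
         sigma * \det (gram t Q).
    rewrite SE mulmx_block !mulmx1 !mulmx0 !mulmxN eE subrr !add0r sE.
    by rewrite det_ublock det_scalar1.
  by rewrite det_mulmx det_lblock !det1 !mulr1.
have s0 : 0 < sigma.
  by have := det_gram_gt0 (col_mx q Q) t0; rewrite dS pmulr_lgt0.
pose b := (beta^T *m y0) 0 0.
(* Block elimination: [y1] is the first coordinate of the solution [y] for the column
   [col_mx x%:M u], and the other coordinates are those of [y0] corrected by a multiple of [e]. *)
exists b => x; pose y1 := (x - b) / sigma.
pose y := col_mx y1%:M (y0 - y1 *: e).
have yE : gram t (col_mx q Q) *m y = col_mx x%:M u.
  rewrite SE /y mul_block_col !mulmxBr -!scalemxAr eE y0E !mul_mx_scalar.
  congr col_mx; last by rewrite addrC subrK.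
  have -> : beta^T *m y0 = b%:M by rewrite [LHS]mx11_scalar.
  rewrite addrCA -scalerBr sE scale_scalar_mx -raddfD /=; congr _%:M.
  by rewrite /y1 divfK ?lt0r_neq0 // addrC subrK.
rewrite -yE det_gram_row_mx yE -y0E det_gram_row_mx y0E dS.
have -> : ((col_mx x%:M u)^T *m y) 0 0 = (u^T *m y0) 0 0 + y1 * (x - b).
  rewrite tr_col_mx /y mul_row_col tr_scalar_mx mul_scalar_mx scale_scalar_mx.
  rewrite mulmxBr -scalemxAr.
  have -> : u^T *m e = b%:M.
    rewrite [LHS]mx11_scalar /b mul_colC -y0E -eE !trmx_mul !tr_gram.
    by rewrite !mulmxA.
  by rewrite !mxE /=; ring.
by rewrite /y1; field; rewrite !lt0r_neq0.
Qed.

(** Pythagoras: the rows of [K] are split along the unit vector [v] and orthogonally to it. *)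
Lemma sqnorm_split m n (K : 'M[R]_(m, n)) (v : 'rV_n) : sqnorm v = 1 ->
  sqnorm K = sqnorm (K - K *m v^T *m v) + sqnorm (K *m v^T).
Proof.
move=> v1.
have vv : v *m v^T = 1%:M by apply/matrixP => i j; rewrite !ord1 -sqnorm_row v1 mxE.
rewrite /sqnorm -linearD /= trmxB !trmx_mul trmxK mulmxBl !mulmxBr.
rewrite -[K *m v^T *m v *m (v^T *m _)]mulmxA [v *m (v^T *m _)]mulmxA vv mul1mx.
by rewrite !mulmxA subrr subr0 subrK.
Qed.

(** [v] is a nonzero row of [K], normalised. After the projection all rows are orthogonal to [v] and
    still in the row space of [K], which contains [v]; hence the new row space is strictly
    smaller. *)
Lemma rank_reduction m n (K : 'M[R]_(m, n)) : K != 0 ->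
  exists v : 'rV_n, [/\ sqnorm v = 1, K *m v^T != 0 &
    (\rank (K - K *m v^T *m v)%R < \rank K)%N].
Proof.
move=> K0.
have [i Ki0] : exists i, row i K != 0.
  apply/existsP; apply: contraNT K0; rewrite negb_exists => /forallP H.
  by apply/eqP/row_matrixP => i; rewrite row0; apply/eqP; have := H i; rewrite negbK.
pose w := row i K.
have w0 : 0 < sqnorm w by rewrite lt_def sqnorm_eq0 Ki0 sqnorm_ge0.
pose l := (Num.sqrt (sqnorm w))^-1.
have l0 : 0 < l by rewrite invr_gt0 sqrtr_gt0.
have v1 : sqnorm (l *: w) = 1.
  rewrite sqnorm_row trmxZ -scalemxAl -scalemxAr scalerA mxE -sqnorm_row.
  by rewrite /l -expr2 exprVn sqr_sqrtr ?ltW// mulVf ?gt_eqF.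
have vv : (l *: w) *m (l *: w)^T = 1%:M.
  by apply/matrixP => j k; rewrite !ord1 -sqnorm_row v1 mxE.
exists (l *: w); split => //.
  apply/eqP => /(congr1 (row i)); rewrite row_mul -/w row0 trmxZ -scalemxAr => /matrixP/(_ 0 0).
  by rewrite mxE -sqnorm_row mxE => /eqP; rewrite mulf_eq0 !gt_eqF.
set v := l *: w in v1 vv *.
have vK : (v <= K)%MS by rewrite scalemx_sub // row_sub.
have K1K : (K - K *m v^T *m v <= K)%MS.
  by rewrite addmx_sub // eqmx_opp mulmx_sub.
suff : (K - K *m v^T *m v < K)%MS by rewrite ltmxErank => /andP[].
rewrite ltmxE K1K /=; apply: contraTN vK => KK1; apply/negP => vK.
(* A [v] in the reduced row space would satisfy v v^T = 0, against v v^T = 1. *)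
have /submxP[D vE] := submx_trans vK KK1.
have := congr1 (mulmx^~ v^T) vE; rewrite /= vv -[D *m _ *m _]mulmxA mulmxBl -[K *m v^T *m v *m v^T]mulmxA vv.
rewrite mulmx1 subrr mulmx0 => /matrixP/(_ 0 0); rewrite !mxE => /eqP.
by rewrite oner_eq0.
Qed.

End gram_determinant.

(** * Growth of the Gram determinant under a perturbation of given rank *)

Section gram_perturbation.
Context {R : realType}.

(** The right-hand side is the tangent at c^2 of the concave function x -> ln (1 + sqrt x),
    evaluated at y^2. It follows from ln (1 + h) <= h and 2 c (y - c) <= y^2 - c^2. *)
Let ln1D_tangent (c y : R) : 0 < c -> 0 <= y ->
  ln (1 + y) <= ln (1 + c) + (y ^+ 2 / c - c) / (2 * (1 + c)).
Proof.
move=> c0 y0.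
have c1 : 0 < 1 + c by rewrite addr_gt0.
have y1 : 0 < 1 + y by rewrite ltr_pwDl.
rewrite -lerBlDl -ln_div ?posrE //.
apply: (@le_trans _ _ ((1 + y) / (1 + c) - 1)).
  rewrite -[X in ln X](subrK 1) addrC; apply: le_ln1Dx.
  by rewrite ltrBrDl subrr divr_gt0.
have -> : (1 + y) / (1 + c) - 1 = (y - c) / (1 + c) by field; rewrite gt_eqF.
have -> : (y ^+ 2 / c - c) / (2 * (1 + c)) = ((y ^+ 2 / c - c) / 2) / (1 + c).
  by field; rewrite !gt_eqF.
rewrite ler_pM2r ?invr_gt0 // ler_pdivlMr // lerBrDr ler_pdivlMr //.
by have := sqr_ge0 (y - c); nra.
Qed.

(* Peel off one direction [v] of the row space of [K] at a time: the update by
   [K v^T v] multiplies the determinant by at most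
   [1 + s + s^2 <= (1 + s / sqrt 2)^4], with [s = |K v^T| / sqrt t]. The sum of
   the [ln (1 + s / sqrt 2)] is bounded by concavity, through the tangent of
   [ln (1 + sqrt _)] at [c^2]. *)
Lemma det_gram_add_le_expR m n (t c : R) (M K : 'M[R]_(m, n)) : 0 < t -> 0 < c ->
  \det (gram t (M + K)) <=
  expR (4 * ((\rank K)%:R * (ln (1 + c) - c / (2 * (1 + c))) +
             sqnorm K / (4 * t * c * (1 + c)))) * \det (gram t M).
Proof.
move=> t0 c0.
have [r] := ubnP (\rank K); elim: r => // r IH in K *; rewrite ltnS => Kr.
have [->|K0] := eqVneq K 0.
  by rewrite addr0 mxrank0 mul0r add0r /sqnorm mul0mx linear0 mul0r mulr0 expR0 mul1r.
have [v [v1 Kv0 K1r]] := rank_reduction K0.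
set K1 := K - K *m v^T *m v in K1r *; set u := K *m v^T in Kv0 *.
have -> : M + K = M + K1 + u *m v by rewrite -addrA subrK.
have u0 : 0 < sqnorm u by rewrite lt_def sqnorm_eq0 Kv0 sqnorm_ge0.
pose y := Num.sqrt (sqnorm u / (2 * t)).
pose s := Num.sqrt (sqnorm u / t).
have s0 : 0 < s by rewrite sqrtr_gt0 divr_gt0.
have y0 : 0 < y by rewrite sqrtr_gt0 divr_gt0 // mulr_gt0.
have s2 : s ^+ 2 = sqnorm u / t by rewrite sqr_sqrtr // divr_ge0 // ltW.
have y2 : y ^+ 2 = sqnorm u / (2 * t) by rewrite sqr_sqrtr // divr_ge0 ?ltW // mulr_gt0.
have sy : s ^+ 2 = 2 * y ^+ 2 by rewrite s2 y2; field; rewrite gt_eqF.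
apply: (le_trans (det_gram_rank1_le (s := s) (M + K1) t0 s0 v1 _)).
  by rewrite s2 divfK ?gt_eqF.
have step : 1 + s + s ^+ 2 <= expR (4 * ln (1 + y)).
  have y1 : 0 < 1 + y by rewrite addr_gt0.
  rewrite expRM_natl lnK ?posrE //.
  have sy2 : s <= 2 * y by rewrite -(ler_sqr _ _) ?nnegrE ?mulr_ge0 ?ltW // sy exprMn; nra.
  rewrite sy (_ : (1 + y) ^+ 4 = 1 + 4 * y + 6 * y ^+ 2 + y ^+ 3 * (4 + y)); last by ring.
  have : 0 <= y ^+ 3 * (4 + y) by rewrite mulr_ge0 ?exprn_ge0 ?addr_ge0 // ltW.
  have := sqr_ge0 y; lra.
apply: (le_trans (ler_wpM2r (ltW (det_gram_gt0 _ t0)) step)).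
apply: (le_trans (ler_wpM2l (expR_ge0 _) (IH K1 (leq_trans K1r Kr)))).
rewrite mulrA -expRD ler_wpM2r ?(ltW (det_gram_gt0 _ t0)) // ler_expR -mulrDr ler_wpM2l //.
(* At y = 0 the tangent bound makes the charge per unit of rank nonnegative, so a drop of the rank
   by more than one is harmless. *)
have kc : 0 <= ln (1 + c) - c / (2 * (1 + c)).
  have := ln1D_tangent c0 (lexx 0).
  rewrite addr0 ln1 expr0n mul0r add0r mulNr; lra.
have : (\rank K1)%:R + 1 <= (\rank K)%:R :> R by rewrite natr1 ler_nat.
move=> /(ler_wpM2r kc); rewrite mulrDl mul1r.
have -> : sqnorm K = sqnorm K1 + sqnorm u by exact: sqnorm_split.
have := ln1D_tangent c0 (ltW y0).
rewrite y2 (_ : (sqnorm u / (2 * t) / c - c) / (2 * (1 + c)) =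
  sqnorm u / (4 * t * c * (1 + c)) - c / (2 * (1 + c))); last first.
  by field; rewrite !gt_eqF //= addr_gt0.
rewrite mulrDl; lra.
Qed.

(** The tangent point [c] is the value reached when [r] peeled directions share the norm of [K]
    equally, c^2 = |K|_F^2 / (2 r t). The two correction terms then cancel and 4 r ln (1 + c)
    remains. *)
Lemma det_gram_add_le m n (t : R) (M K : 'M[R]_(m, n)) : 0 < t -> K != 0 ->
  \det (gram t (M + K)) <=
  expR (4 * (\rank K)%:R * ln (1 + Num.sqrt (sqnorm K / (2 * (\rank K)%:R * t)))) *
  \det (gram t M).
Proof.
move=> t0 K0; set r : R := (\rank K)%:R.
have r0 : 0 < r by rewrite ltr0n lt0n mxrank_eq0.
have k0 : 0 < sqnorm K by rewrite lt_def sqnorm_eq0 K0 sqnorm_ge0.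
set c := Num.sqrt _.
have c0 : 0 < c by rewrite sqrtr_gt0 divr_gt0 // !mulr_gt0.
have c2 : c ^+ 2 = sqnorm K / (2 * r * t).
  by rewrite sqr_sqrtr // divr_ge0 ?ltW // !mulr_gt0.
have kE : sqnorm K = 2 * r * t * c ^+ 2 by rewrite c2; field; rewrite !gt_eqF.
apply: (le_trans (det_gram_add_le_expR M K t0 c0)).
rewrite -/r {}kE (_ : 4 * _ = 4 * r * ln (1 + c)) //.
by field; rewrite !gt_eqF //= addr_gt0.
Qed.

End gram_perturbation.

(** * One-dimensional Student integrals *)

Section student_integral.
Context {R : realType}.
Local Notation mu := (@lebesgue_measure R).

(** Kept in the extended reals: finiteness is proved separately, for [1 <= s]. *)
Definition student_mass (s : R) : \bar R := (\int[mu]_x ((1 + x ^+ 2) `^ (- s))%:E)%E.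

Let sq1_gt0 (x : R) : 0 < 1 + x ^+ 2.
Proof. by rewrite ltr_pwDl ?sqr_ge0. Qed.

Let continuous_kernel (s : R) : continuous (fun x : R => (1 + x ^+ 2) `^ (- s)).
Proof.
move=> x.
rewrite (_ : (fun x => _) = fun x : R => expR (- s * ln (1 + x ^+ 2))); last first.
  by apply/funext => y; rewrite /powR gt_eqF.
apply: continuous_comp; last exact: continuous_expR.
apply: cvgM; first exact: cvg_cst.
apply: continuous_comp; last exact: continuous_ln.
exact: continuous_oneDsqr.
Qed.

Lemma measurable_shifted_kernel (a b m s : R) :
  measurable_fun [set: R] (fun x => (a * (x - b) ^+ 2 + m) `^ s).
Proof.
apply: (measurableT_comp (measurable_powR _)).
apply: measurable_funD => //; apply: measurable_funM => //.
by apply: measurable_funX; exact: measurable_funB.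
Qed.

(** Substitution y = sqrt (a / m) (x - b), under which the base becomes m (1 + y^2). *)
Lemma integral_quadratic_powR (a b m s : R) : 0 < a -> 0 < m ->
  (\int[mu]_x ((a * (x - b) ^+ 2 + m) `^ (- s))%:E =
   student_mass s * (a `^ (- 2^-1) * m `^ (2^-1 - s))%:E)%E.
Proof.
move=> a0 m0.
pose l : R := Num.sqrt (a / m).
have l0 : 0 < l by rewrite sqrtr_gt0 divr_gt0.
have l2 : l ^+ 2 = a / m by rewrite sqr_sqrtr // divr_ge0 ?ltW.
pose F : R -> R := fun x => l * (x - b).
have dF (x : R) : is_derive x (1 : R) F l.
  have : is_derive x (1 : R) (l *: (id - cst b : R -> R)) (l *: ((1 : R) - 0)).
    exact: is_deriveZ.
  by rewrite subr0 /GRing.scale /= mulr1.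
have F' : (F^`())%classic = cst l.
  by apply/funext => x; rewrite derive1E derive_val.
pose G : R -> R := fun y => (1 + y ^+ 2) `^ (- s).
have -> : student_mass s = (\int[mu]_x (((G \o F) * F^`()%classic) x)%:E)%E.
  apply: increasing_ge0_integration_by_substitutionT.
  - by move=> x y xy; rewrite /F ltr_pM2l // ltrD2r.
  - by rewrite F'; by move=> x; exact: cvg_cst.
  - by rewrite F'; apply: (cvgP l); exact: cvg_cst.
  - by rewrite F'; apply: (cvgP l); exact: cvg_cst.
  - by move=> x; exact: ex_derive.
  - apply/cvgrNyPle => A; near=> x; rewrite /F -ler_pdivlMl // lerBlDr.
    by near: x; apply: nbhs_ninfty_le; exact: num_real.
  - apply/cvgryPge => A; near=> x; rewrite /F -ler_pdivrMl // lerBrDr.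
    by near: x; apply: nbhs_pinfty_ge; exact: num_real.
  - exact: continuous_kernel.
  - by move=> x; exact: powR_ge0.
have mG : measurable_fun setT (fun x => (((G \o F) * F^`()%classic) x)%:E).
  apply/measurable_EFinP; apply: measurable_funM; last by rewrite F'; exact: measurable_cst.
  rewrite (_ : _ \o _ = fun x => (l ^+ 2 * (x - b) ^+ 2 + 1) `^ (- s)).
    exact: measurable_shifted_kernel.
  by apply/funext => x /=; rewrite /G /F exprMn addrC.
have G0 x : (0 <= (((G \o F) * F^`()%classic) x)%:E)%E.
  by rewrite lee_fin F' mulr_ge0 ?powR_ge0 // ltW.
rewrite -ge0_integralZr //; last by rewrite lee_fin mulr_ge0 ?powR_ge0.
apply: eq_integral => x _; rewrite F' -EFinM; congr EFin.
rewrite -[((G \o F) * cst l) x]/((1 + F x ^+ 2) `^ (- s) * l).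
have -> : a * (x - b) ^+ 2 + m = m * (1 + F x ^+ 2).
  by rewrite /F exprMn l2; field; rewrite gt_eqF.
rewrite powRM ?(ltW (sq1_gt0 _)) ?ltW //.
have -> : l = a `^ 2^-1 * m `^ (- 2^-1).
  rewrite /l -powR12_sqrt ?divr_ge0 ?ltW // powRM ?invr_ge0 ?ltW //.
  by rewrite -(powR_inv1 (ltW m0)) -powRrM mulN1r.
have am : a `^ 2^-1 * a `^ (- 2^-1) = 1 
  by rewrite -powRD ?subrr ?powRr0 // (gt_eqF a0) implybT.
have mm : m `^ (- 2^-1) * m `^ (2^-1 - s) = m `^ (- s).
  by rewrite -powRD ?addKr // (gt_eqF m0) implybT.
rewrite -mm /G /= /cst.
rewrite [RHS](_ : _ = m `^ (- 2^-1) * m `^ (2^-1 - s) * (1 + F x ^+ 2) `^ (- s) *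
  (a `^ 2^-1 * a `^ (- 2^-1))); last by ring.
by rewrite am mulr1.
Unshelve. all: by end_near. Qed.

Let mkernel (s : R) : measurable_fun [set: R] (fun x : R => (1 + x ^+ 2) `^ (- s)).
Proof. by apply: continuous_measurable_fun; exact: continuous_kernel. Qed.

(** On [-1, 1] the base 1 + x^2 is at most 2. *)
Lemma student_mass_ge (s : R) : 0 <= s -> ((2 * 2 `^ (- s))%:E <= student_mass s)%E.
Proof.
move=> s0.
apply: (@le_trans _ _ (\int[mu]_(x in `[(-1)%R, 1%R]) (cst (2 `^ (- s))%:E x))%E).
  have N11 : -1 < 1 :> R by lra.
  rewrite integral_cst //= lebesgue_measure_itv /= lte_fin N11 -EFinD opprK -EFinM.
  by rewrite lee_fin mulrC.
apply: (@le_trans _ _ (\int[mu]_(x in `[(-1)%R, 1%R]) ((1 + x ^+ 2) `^ (- s))%:E)%E).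
  apply: ge0_le_integral => //=.
  - by apply/measurable_EFinP; apply: measurable_funTS; exact: mkernel.
  - move=> x /=; rewrite in_itv /= => /andP[x0 x1]; rewrite lee_fin !powRN lef_pV2 ?posrE ?powR_gt0 //.
    rewrite ge0_ler_powR ?nnegrE ?(ltW (sq1_gt0 _)) // (_ : 2 = 1 + 1) // lerD2l.
    by rewrite -subr_ge0 (_ : _ - _ = (1 - x) * (x + 1)) ?mulr_ge0 ?subr_ge0 -?lerBlDr ?sub0r //; ring.
apply: ge0_subset_integral => //=.
- by apply/measurable_EFinP; exact: mkernel.
- by move=> x _; rewrite lee_fin powR_ge0.
Qed.

(** The integral over the positive half line is pi / 2, and the reflection x -> - x doubles it. *)
Let student_mass1 : student_mass 1 = (pi%:E)%E.
Proof.
have kE (x : R) : (1 + x ^+ 2) `^ (- 1) = (oneDsqr x)^-1 by rewrite powR_inv1 ?ltW.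
have m1 : measurable_fun [set: R] (fun x : R => ((oneDsqr x)^-1)%:E).
  apply/measurable_EFinP; apply: (eq_measurable_fun _ _ (mkernel 1)) => x _.
  by rewrite kE.
have k0 (x : R) : (0 <= ((oneDsqr x)^-1)%:E)%E by rewrite lee_fin invr_ge0.
rewrite /student_mass; under eq_integral do rewrite kE.
rewrite -(setUv `]-oo, 0%R]%classic) setCitvl ge0_integral_setU //=; first last.
- rewrite disj_set2E; apply/eqP; rewrite -subset0 => x [] /=.
  by rewrite !in_itv /= andbT leNgt => /negP.
- exact: measurable_funTS.
rewrite (integral_itv_obnd_cbnd (r := 0)); last exact: measurable_funTS.
rewrite integral0y_oneDsqr.
rewrite (_ : \int[mu]_(x in `]-oo, 0%R]) _ = (pi / 2)%:E)%E.
  by rewrite -EFinD -splitr.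
rewrite -integral0y_oneDsqr ge0_integration_by_substitution0 //.
by apply: eq_integral => x _; rewrite /oneDsqr sqrrN.
Qed.

Lemma student_mass_fin (s : R) : 1 <= s -> student_mass s \is a fin_num.
Proof.
move=> s1; rewrite ge0_fin_numE; last by apply: integral_ge0 => x _; rewrite lee_fin powR_ge0.
apply: (@le_lt_trans _ _ (student_mass 1)); last by rewrite student_mass1 ltry.
apply: ge0_le_integral => //=.
- by move=> x _; rewrite lee_fin powR_ge0.
- by apply/measurable_EFinP; exact: mkernel.
- by apply/measurable_EFinP; exact: mkernel.
- by move=> x _; rewrite lee_fin ler_powR ?lerN2 // lerDl sqr_ge0.
Qed.

(** pi < 4 = 8 (2 / 2^2), the last factor being the lower bound for [student_mass 2]. The factor 8
    yields the constant 4 in the first moment of an entry. *)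
Lemma student_mass1_le : (student_mass 1 <= 8%:E * student_mass 2)%E.
Proof.
rewrite student_mass1.
apply: (@le_trans _ _ (8%:E * (2 * 2 `^ (- 2))%:E))%E; last first.
  by rewrite lee_pmul2l // student_mass_ge.
rewrite -EFinM lee_fin powRN powR_mulrn //.
have := @pihalf_lt2 R; lra.
Qed.

End student_integral.

(** * Lebesgue measure on matrices *)

Section lebesgue_mx_theory.
Context {R : realType}.

Lemma measurable_mx_of_tuple m n :
  measurable_fun setT (@mx_of_tuple R m n).
Proof. by move=> _ B mB; rewrite setTI. Qed.

Lemma measurable_fun_mx d (T : measurableType d) m n (f : T -> 'M[R]_(m, n)) :
  (forall i j, measurable_fun setT (fun x => f x i j)) -> measurable_fun setT f.
Proof.
move=> mf.
have mg : measurable_fun setT (fun x => tuple_of_mx (f x)).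
  apply/measurable_fun_tnthP => k.
  case/mxvec_indexP: k => i j.
  rewrite (_ : _ \o _ = fun x => f x i j); first exact: mf.
  by apply/funext => x /=; rewrite tnth_mktuple mxvecE.
rewrite (_ : f = @mx_of_tuple R m n \o (fun x => tuple_of_mx (f x))).
  by apply: (measurableT_comp _ mg); exact: measurable_mx_of_tuple.
by apply/funext => x /=; rewrite tuple_of_mxK.
Qed.

Definition box m n (A : 'I_m -> 'I_n -> set R) : set 'M[R]_(m, n) :=
  [set M | forall i j, A i j (M i j)].

Lemma measurable_box m n (A : 'I_m -> 'I_n -> set R) :
  (forall i j, measurable (A i j)) -> measurable (box A).
Proof.
move=> mA.
rewrite (_ : box A = \bigcap_(k in [set: 'I_m * 'I_n])
    ((fun M : 'M[R]_(m, n) => M k.1 k.2) @^-1` A k.1 k.2)).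
  apply: fin_bigcap_measurable; first exact: finite_finset.
  by move=> k _; rewrite -[X in measurable X]setTI; exact: measurable_entry.
apply/seteqP; split => [M HM [i j] _|M HM i j]; first exact: HM.
exact: (HM (i, j)).
Qed.

Let boxes m n : set (set 'M[R]_(m, n)) :=
  [set box A | A in [set A | forall i j, measurable (A i j)]].

(** For the inclusion that is not immediate, it suffices to treat the coordinate sets that generate
    the sigma-algebra of tuples: each corresponds to a rectangle that constrains a single entry. *)
Let boxesE m n : @measurable _ 'M[R]_(m, n) = <<s @boxes m n >>.
Proof.
apply/seteqP; split; last first.
  apply: smallest_sub; first exact: sigma_algebra_measurable.
  by move=> _ [A mA <-]; exact: measurable_box.
move=> X mX.
suff sub : @measurable _ ((m * n).-tuple R) `<=`
    [set Y | <<s @boxes m n >> (tuple_of_mx @^-1` Y)].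
  have := sub _ mX; rewrite /= -comp_preimage (_ : _ \o _ = id) //.
  by apply/funext => M /=; rewrite tuple_of_mxK.
apply: smallest_sub.
  split => /=.
  - by rewrite preimage_set0; exact: sigma_algebra0.
  - by move=> Y; rewrite setTD -preimage_setC => sY; exact: sigma_algebraC.
  - by move=> F sF; rewrite preimage_bigcup; exact: sigma_algebra_bigcup.
apply: (big_ind (fun S : set (set ((m * n).-tuple R)) =>
  S `<=` [set Y | <<s @boxes m n >> (tuple_of_mx @^-1` Y)])) => //.
  by move=> S1 S2 H1 H2 Y [/H1|/H2].
move=> k _ _ [B mB <-]; case/mxvec_indexP: k => i j.
apply: sub_sigma_algebra.
exists (fun i' j' => if (i', j') == (i, j) then B else setT).
  by move=> i' j'; case: ifP.
rewrite setTI; apply/seteqP; split => M /=.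
  by move=> /(_ i j); rewrite eqxx tnth_mktuple mxvecE.
rewrite tnth_mktuple mxvecE => BM i' j'.
by case: ifP => // /eqP[-> ->].
Qed.

Let cube m n (k : nat) : set 'M[R]_(m, n) :=
  box (fun _ _ => `[- k%:R, k%:R]%classic).

Let bigcup_cube m n : \bigcup_k (@cube m n k) = setT.
Proof.
rewrite -subTset => M _.
pose c := \sum_i \sum_j `|M i j|.
exists (Num.truncn c).+1 => // i j /=; rewrite in_itv /= -ler_norml.
apply: le_trans (ltW (truncnS_gt _)).
rewrite /c (bigD1 i) //= (bigD1 j) //= -addrA lerDl addr_ge0 //.
  by rewrite sumr_ge0.
by rewrite sumr_ge0 // => k _; rewrite sumr_ge0.
Qed.

Let lebesgue_mx_cube m n k : (lebesgue_mx (@cube m n k) < +oo)%E.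
Proof.
rewrite lebesgue_mx_box // -ge0_fin_numE.
  apply: prode_fin_num => i _; apply: prode_fin_num => j _.
  by rewrite lebesgue_measure_itv /= fun_if /=; case: ifP.
by apply: prode_ge0 => i _; apply: prode_ge0.
Qed.

(** Rectangles are stable under intersection and generate the sigma-algebra, and the cubes exhaust
    the space with finite measure; agreement on rectangles is therefore enough. *)
Lemma lebesgue_mx_unique m n (mu : {measure set 'M[R]_(m, n) -> \bar R}) :
  (forall A, (forall i j, measurable (A i j)) ->
    mu (box A) = (\prod_(i < m) \prod_(j < n) @lebesgue_measure R (A i j))%E) ->
  forall X, measurable X -> lebesgue_mx X = mu X.
Proof.
move=> muE X mX.
apply: (measure_unique (@boxes m n) (@cube m n)) => //.
- exact: boxesE.
- move=> _ _ [A mA <-] [B mB <-]; exists (fun i j => A i j `&` B i j).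
    by move=> i j; exact: measurableI.
  apply/seteqP; split => M /=.
    by move=> H; split => i j; have [] := H i j.
  by move=> [HA HB] i j; split; [exact: HA|exact: HB].
- by move=> k; exists (fun _ _ => `[- k%:R, k%:R]%classic).
- exact: bigcup_cube.
- by move=> _ [A mA <-]; rewrite muE // -lebesgue_mx_box.
- exact: lebesgue_mx_cube.
Qed.

Let lebesgue_mx_sigma_finite m n : sigma_finite setT (@lebesgue_mx R m n).
Proof.
exists (@cube m n); first by rewrite bigcup_cube.
by move=> k; split; [exact: measurable_box|exact: lebesgue_mx_cube].
Qed.

HB.instance Definition _ m n := Measure_isSigmaFinite.Build _ _ _
  (@lebesgue_mx R m n) (@lebesgue_mx_sigma_finite m n).


(** The push-forward of [mu] by [phi] is identified on rectangles. This serves translations, the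
    splitting of the first column, and matrices without columns. *)
Lemma ge0_integral_lebesgue_mx_transfer d (T : measurableType d) m n
    (mu : {measure set T -> \bar R}) (phi : T -> 'M[R]_(m, n)) (f : 'M[R]_(m, n) -> \bar R) :
  measurable_fun setT phi ->
  (forall A, (forall i j, measurable (A i j)) ->
    mu (phi @^-1` box A) = (\prod_(i < m) \prod_(j < n) @lebesgue_measure R (A i j))%E) ->
  measurable_fun setT f -> (forall M, 0 <= f M)%E ->
  (\int[@lebesgue_mx R m n]_M f M = \int[mu]_x f (phi x))%E.
Proof.
move=> mphi muE mf f0.
pose psi : {mfun T >-> 'M[R]_(m, n)} := HB.pack phi (isMeasurableFun.Build _ _ _ _ phi mphi).
rewrite (@eq_measure_integral _ _ _ _ (pushforward mu psi)).
  by rewrite ge0_integral_pushforward.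
by move=> X mX _; apply: (@lebesgue_mx_unique _ _ (pushforward mu psi)).
Qed.

Let lebesgue_measure_shift (c : R) (A : set R) : measurable A ->
  @lebesgue_measure R ((fun x : R => x + c) @^-1` A) = lebesgue_measure A.
Proof.
pose f : measurableTypeR R -> measurableTypeR R := fun x => x + c.
have mf : measurable_fun setT f by exact: measurable_funD.
pose phi : {mfun measurableTypeR R >-> measurableTypeR R} :=
  HB.pack f (isMeasurableFun.Build _ _ _ _ f mf).
move=> mA; apply/esym.
apply: (@lebesgue_measure_unique _ (pushforward lebesgue_measure phi)) => //= _ [[a b]] _ <-.
rewrite /pushforward (_ : _ @^-1` _ = `](a - c), (b - c)]%classic).
  rewrite !lebesgue_measure_itv /= !lte_fin ltrBlDr subrK.
  by rewrite -!EFinD opprB addrA subrK.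
by apply/seteqP; split => x /=; rewrite !in_itv /= /f ltrBlDr lerBrDr.
Qed.

Lemma measurable_addmx m n (C : 'M[R]_(m, n)) : 
  measurable_fun setT (fun M : 'M[R]_(m, n) => M + C).
Proof.
apply: measurable_fun_mx => i j.
rewrite (_ : (fun _ => _) = fun M : 'M[R]_(m, n) => M i j + C i j).
  by apply: measurable_funD => //; exact: measurable_entry.
by apply/funext => M; rewrite mxE.
Qed.

Lemma ge0_integral_lebesgue_mx_shift m n (C : 'M[R]_(m, n)) (f : 'M[R]_(m, n) -> \bar R) :
  measurable_fun setT f -> (forall M, 0 <= f M)%E ->
  (\int[@lebesgue_mx R m n]_M f M = \int[@lebesgue_mx R m n]_M f (M + C)%R)%E.
Proof.
apply: ge0_integral_lebesgue_mx_transfer; first exact: measurable_addmx.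
move=> A mA; rewrite (_ : _ @^-1` _ = box (fun i j => (fun x => x + C i j) @^-1` A i j)).
  rewrite [LHS]lebesgue_mx_box; last first.
    by move=> i j; rewrite -[X in measurable X]setTI; exact: measurable_funD.
  by apply: eq_bigr => i _; apply: eq_bigr => j _; exact: lebesgue_measure_shift.
by apply/seteqP; split => M /= H i j; have := H i j; rewrite mxE.
Qed.

Lemma ge0_integral_lebesgue_tuple_cons n (f : n.+1.-tuple R -> \bar R) :
  measurable_fun setT f -> (forall u, 0 <= f u)%E ->
  (\int[lebesgue_tuple n.+1]_u f u =
   \int[lebesgue_tuple n]_u \int[@lebesgue_measure R]_x f (tcons (x, u)))%E.
Proof.
move=> mf f0.
have mt := @measurable_tcons R n.
pose psi : {mfun (R * n.-tuple R)%type >-> n.+1.-tuple R} :=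
  HB.pack (@tcons R n) (isMeasurableFun.Build _ _ _ _ _ mt).
rewrite (@eq_measure_integral _ _ _ _
  (pushforward (@lebesgue_measure R \x lebesgue_tuple n)%E psi)) //.
rewrite ge0_integral_pushforward // preimage_setT fubini_tonelli2 //; first exact: measurableT_comp.
by move=> x; exact: f0.
Qed.

Definition col_of_tuple n (u : n.-tuple R) : 'cV[R]_n := \col_i tnth u i.

(** Pairs of a column and a remaining block carry the product measure. The column is the inner
    variable, to be integrated out with [Q] fixed. *)
Lemma ge0_integral_lebesgue_mx_row_mx m n (f : 'M[R]_(m, 1 + n) -> \bar R) :
  measurable_fun setT f -> (forall M, 0 <= f M)%E ->
  (\int[@lebesgue_mx R m (1 + n)]_M f M =
   \int[@lebesgue_mx R m n]_Q \int[lebesgue_tuple m]_u f (row_mx (col_of_tuple u) Q))%E.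
Proof.
move=> mf f0.
pose phi (x : m.-tuple R * 'M[R]_(m, n)) := row_mx (col_of_tuple x.1) x.2.
have mphi : measurable_fun setT phi.
  apply: measurable_fun_mx => i j; rewrite /phi.
  case: (splitP j) => k jE.
    rewrite (_ : (fun _ => _) = fun x : (m.-tuple R * 'M[R]_(m, n))%type => tnth x.1 i).
      exact: (measurableT_comp (measurable_tnth i) measurable_fst).
    apply/funext => x; rewrite (_ : j = lshift n k); last exact/val_inj.
    by rewrite row_mxEl mxE.
  rewrite (_ : (fun _ => _) = fun x : (m.-tuple R * 'M[R]_(m, n))%type => x.2 i k).
    exact: (measurableT_comp (measurable_entry i k) measurable_snd).
  apply/funext => x; rewrite (_ : j = rshift 1 k); last exact/val_inj.
  by rewrite row_mxEr.
suff muE A : (forall i j, measurable (A i j)) ->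
    (lebesgue_tuple m \x @lebesgue_mx R m n)%E (phi @^-1` box A) =
    (\prod_(i < m) \prod_(j < 1 + n) @lebesgue_measure R (A i j))%E.
  rewrite (ge0_integral_lebesgue_mx_transfer mphi muE) // fubini_tonelli2 //.
  exact: measurableT_comp.
move=> mA.
pose A1 : 'I_m -> set R := fun i => A i (lshift n ord0).
pose A2 : 'I_m -> 'I_n -> set R := fun i j => A i (rshift 1 j).
rewrite (_ : _ @^-1` _ = [set u | forall i, A1 i (tnth u i)] `*` box A2).
  rewrite product_measure1E; last 2 first.
  - rewrite (_ : [set u | _] = \bigcap_(i in [set: 'I_m])
        ((fun u : m.-tuple R => tnth u i) @^-1` A1 i)).
      apply: fin_bigcap_measurable; first exact: finite_finset.
      move=> i _; rewrite -[X in measurable X]setTI; apply: measurable_tnth => //.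
      exact: mA.
    by apply/seteqP; split => u H i => [_|]; exact: H.
  - by apply: measurable_box => i j; exact: mA.
  rewrite [X in (X * _)%E](lebesgue_tuple_box (A := A1)); last by move=> i; exact: mA.
  rewrite [X in (_ * X)%E]lebesgue_mx_box; last by move=> i j; exact: mA.
  rewrite -big_split /=.
  by apply: eq_bigr => i _; rewrite big_split_ord /= big_ord1.
apply/seteqP; split => -[u Q] /=.
  move=> H; split => [i|i j].
    by have := H i (lshift n ord0); rewrite /phi row_mxEl mxE.
  by have := H i (rshift 1 j); rewrite /phi row_mxEr.
move=> [H1 H2] i j; rewrite /phi; case: (splitP j) => k jE.
  rewrite (_ : j = lshift n k); last exact/val_inj.
  by rewrite row_mxEl mxE ord1; exact: H1.
rewrite (_ : j = rshift 1 k); last exact/val_inj.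
by rewrite row_mxEr; exact: H2.
Qed.

End lebesgue_mx_theory.

(** * Integrals of powers of Gram determinants *)

Section gram_integral.
Context {R : realType}.

Lemma measurable_det_gram m n (t s : R) :
  measurable_fun setT (fun M : 'M[R]_(m, n) => \det (gram t M) `^ s).
Proof.
apply: (measurableT_comp (measurable_powR _)).
rewrite /determinant; apply: measurable_sum => p.
apply: measurable_funM; first exact: measurable_cst.
apply: measurable_prod => i _.
rewrite (_ : (fun _ => _) = fun M : 'M[R]_(m, n) =>
    (t%:M : 'M[R]_m) i (p i) + \sum_k M i k * M (p i) k); last first.
  apply/funext => M; rewrite !mxE; congr (_ + _).
  by apply: eq_bigr => k _; rewrite mxE.
apply: measurable_funD => //; apply: measurable_sum => k.
by apply: measurable_funM; exact: measurable_entry.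
Qed.

Lemma measurable_col_of_tuple n : measurable_fun setT (@col_of_tuple R n).
Proof.
apply: measurable_fun_mx => i j.
rewrite (_ : (fun _ => _) = fun u : n.-tuple R => tnth u i); first exact: measurable_tnth.
by apply/funext => u; rewrite mxE.
Qed.

Lemma measurable_row_mx d (T : measurableType d) m n1 n2
    (f : T -> 'M[R]_(m, n1)) (g : T -> 'M[R]_(m, n2)) :
  measurable_fun setT f -> measurable_fun setT g ->
  measurable_fun setT (fun x => row_mx (f x) (g x)).
Proof.
move=> mf mg; apply: measurable_fun_mx => i j.
case: (split_ordP j) => k ->.
  rewrite (_ : (fun _ => _) = fun x => f x i k); last first.
    by apply/funext => x; rewrite row_mxEl.
  exact: (measurableT_comp (measurable_entry i k) mf).
rewrite (_ : (fun _ => _) = fun x => g x i k); last first.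
  by apply/funext => x; rewrite row_mxEr.
exact: (measurableT_comp (measurable_entry i k) mg).
Qed.

Lemma col_of_tuple_cons n (x : R) (u : n.-tuple R) :
  col_of_tuple (tcons (x, u)) = col_mx (x%:M : 'M[R]_1) (col_of_tuple u).
Proof.
apply/matrixP => i j; rewrite ord1 mxE; case: (unliftP ord0 i) => [k|] ->.
  rewrite tnthS (_ : lift ord0 k = rshift 1 k); last exact/val_inj.
  by apply: esym; apply: etrans; [exact: col_mxEd|rewrite mxE].
rewrite (_ : ord0 = lshift n (0 : 'I_1)); last exact/val_inj.
by apply: esym; apply: etrans; [exact: col_mxEu|rewrite mxE].
Qed.

Lemma measurable_gram_col m n t s (Q : 'M[R]_(m, n)) :
  measurable_fun setT (fun u => \det (gram t (row_mx (col_of_tuple u) Q)) `^ s).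
Proof.
apply: (measurableT_comp (measurable_det_gram _ _)).
by apply: measurable_row_mx => //; exact: measurable_col_of_tuple.
Qed.

Lemma fine_student_mass_gt0 (s : R) : 1 <= s -> 0 < fine (student_mass s).
Proof.
move=> s1; apply: fine_gt0; rewrite -ge0_fin_numE; last first.
  by apply: integral_ge0 => x _; rewrite lee_fin powR_ge0.
rewrite student_mass_fin // andbT.
by apply: lt_le_trans (student_mass_ge _); rewrite ?lte_fin ?mulr_gt0 ?powR_gt0 //; lra.
Qed.

Let powR_half (a : R) : 0 < a -> a `^ (- 2^-1) * a `^ (2^-1) = 1.
Proof. by move=> a0; rewrite -powRD ?addNr ?powRr0 // (gt_eqF a0) implybT. Qed.

(** The entries of the column are integrated from the top. By [det_gram_block] the determinant is
    quadratic in the top entry; integrating it out removes the first row of [Q] and raises the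
    exponent by 1/2. [K] depends only on [m] and [s], and the bound on [s] keeps every
    one-dimensional exponent at least 1. *)
Lemma integral_gram_col m (s : R) : m.+1%:R / 2 <= s ->
  exists2 K : R, 0 < K & forall n t (Q : 'M[R]_(m, n)), 0 < t ->
  (\int[lebesgue_tuple m]_u (\det (gram t (row_mx (col_of_tuple u) Q)) `^ (- s))%:E =
   (K * \det (gram t Q) `^ (2^-1 - s))%:E)%E.
Proof.
elim: m s => [|m IH] s ms.
  exists 1 => // n t Q t0.
  have mf : measurable_fun setT
      (fun u : 0.-tuple R => (\det (gram t (row_mx (col_of_tuple u) Q)) `^ (- s))%:E).
    by apply/measurable_EFinP; exact: measurable_gram_col.
  have E := @integral_dirac _ _ ([tuple] : 0.-tuple R) R setT measurableT _ mf.
  by apply: etrans; [exact: E|rewrite diracT mul1e !det_mx00 !powR1 mulr1].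
have s1 : 1 <= s by apply: le_trans ms; rewrite ler_pdivlMr // mul1r ler_nat.
have [K K0 HK] : exists2 K : R, 0 < K & forall n t (Q : 'M[R]_(m, n)), 0 < t ->
    (\int[lebesgue_tuple m]_u (\det (gram t (row_mx (col_of_tuple u) Q)) `^ (- (s - 2^-1)))%:E =
     (K * \det (gram t Q) `^ (2^-1 - (s - 2^-1)))%:E)%E.
  by apply: IH; move: ms; rewrite -natr1; lra.
have c0 := fine_student_mass_gt0 s1.
exists (K * fine (student_mass s)); first by rewrite mulr_gt0.
move=> n t Q t0.
have mf : measurable_fun setT (fun u : m.+1.-tuple R =>
    \det (gram t (row_mx (col_of_tuple u) Q)) `^ (- s)).
  exact: measurable_gram_col.
rewrite ge0_integral_lebesgue_tuple_cons; first last.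
- by move=> u; rewrite lee_fin powR_ge0.
- exact/measurable_EFinP.
move: Q mf; rewrite -[m.+1]/(1 + m)%N => Q mf.
pose q := usubmx Q; pose Q' := dsubmx Q.
have QE : Q = col_mx q Q' by rewrite vsubmxK.
set a := \det (gram t Q').
have a0 : 0 < a by exact: det_gram_gt0.
set D := \det (gram t Q).
have D0 : 0 < D by exact: det_gram_gt0.
(* The top entry is integrated out. The dependence on [u] survives through the factor [d'] of the
   constant term, with exponent 2^-1 - s. *)
transitivity (\int[lebesgue_tuple m]_u
  ((fine (student_mass s) * (a `^ (- 2^-1) * (D / a) `^ (2^-1 - s)))%:E *
   (\det (gram t (row_mx (col_of_tuple u) Q')) `^ (- (s - 2^-1)))%:E))%E.
  apply: eq_integral => u _.
  set d' := \det (gram t (row_mx (col_of_tuple u) Q')).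
  have d0 : 0 < d' by exact: det_gram_gt0.
  have [b bE] := det_gram_block (col_of_tuple u) q Q' t0.
  rewrite -QE -/a -/D -/d' in bE.
  have fE x : \det (gram t (row_mx (col_of_tuple (tcons (x, u))) Q)) =
      a * (x - b) ^+ 2 + D * d' / a.
    by rewrite col_of_tuple_cons bE.
  under eq_integral => x _ do rewrite fE.
  rewrite integral_quadratic_powR //; last by rewrite divr_gt0 // mulr_gt0.
  rewrite -[student_mass s]fineK ?student_mass_fin // -!EFinM; congr EFin.
  rewrite -!mulrA; congr (_ * (_ * _)).
  rewrite (_ : D * (d' / a) = D / a * d'); last by ring.
  by rewrite powRM ?divr_ge0 ?ltW // opprB.
rewrite ge0_integralZl //; first last.
- by rewrite lee_fin !mulr_ge0 ?powR_ge0 // ltW.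
- by move=> u _; rewrite lee_fin powR_ge0.
- by apply/measurable_EFinP; exact: measurable_gram_col.
rewrite HK // -/a -EFinM; congr EFin.
rewrite powRM ?invr_ge0 ?ltW // -(powR_inv1 (ltW a0)) -powRrM mulN1r opprB.
(* The exponents of [a] are - 1/2, s - 1/2 and 1 - s, which add up to 0. *)
have aE : a `^ (s - 2^-1) = a `^ s * a `^ (- 2^-1).
  by rewrite -powRD // (gt_eqF a0) implybT.
have aE' : a `^ (2^-1 - (s - 2^-1)) = a `^ 2^-1 * a `^ (- s) * a `^ 2^-1.
  by rewrite -!powRD ?(gt_eqF a0) ?implybT //; congr (_ `^ _); lra.
have as1 : a `^ (- s) * a `^ s = 1.
  by rewrite -powRD ?addNr ?powRr0 // (gt_eqF a0) implybT.
have ah := powR_half a0.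
rewrite aE aE'.
transitivity (K * fine (student_mass s) * D `^ (2^-1 - s) * (a `^ (- s) * a `^ s) *
  (a `^ (- 2^-1) * a `^ (2^-1)) * (a `^ (- 2^-1) * a `^ (2^-1))); first by ring.
by rewrite as1 ah !mulr1.
Qed.



Lemma gram_row_mxC m n1 n2 t (M : 'M[R]_(m, n1)) (N : 'M[R]_(m, n2)) :
  gram t (row_mx M N) = gram t (row_mx N M).
Proof. by rewrite !gram_row_mx /gram addrAC. Qed.

Lemma gram_row_mxA m n1 n2 n3 t (M : 'M[R]_(m, n1)) (N : 'M[R]_(m, n2))
    (P : 'M[R]_(m, n3)) :
  gram t (row_mx (row_mx M N) P) = gram t (row_mx M (row_mx N P)).
Proof. by rewrite !gram_row_mx tr_row_mx mul_row_col addrA addrAC. Qed.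

(** One column at a time by [integral_gram_col], each raising the exponent by 1/2. *)
Lemma integral_gram_block m k (s : R) : (m + k)%:R / 2 <= s ->
  exists2 K : R, 0 < K & forall n t (B : 'M[R]_(m, n)), 0 < t ->
  (\int[@lebesgue_mx R m k]_Q (\det (gram t (row_mx Q B)) `^ (- s))%:E =
   (K * \det (gram t B) `^ (k%:R / 2 - s))%:E)%E.
Proof.
elim: k s => [|k IH] s ms.
  exists 1 => // n t B t0.
  have mf : measurable_fun setT
      (fun Q : 'M[R]_(m, 0) => (\det (gram t (row_mx Q B)) `^ (- s))%:E).
    apply/measurable_EFinP; apply: (measurableT_comp (measurable_det_gram _ _)).
    exact: measurable_row_mx.
  have E := @integral_dirac _ _ (0 : 'M[R]_(m, 0)) R setT measurableT _ mf.
  (* Without columns there is a single matrix, and the Dirac mass at it is the Lebesgue measure,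
     since empty products are 1. *)
  have boxE (A : 'I_m -> 'I_0 -> set R) : (forall i j, measurable (A i j)) ->
      (\d_(0 : 'M[R]_(m, 0)) : {measure set _ -> \bar R}) (idfun @^-1` box A) =
      (\prod_(i < m) \prod_(j < 0) @lebesgue_measure R (A i j))%E.
    move=> _; rewrite /= diracE mem_set; last by move=> i [].
    by rewrite big1 // => i _; rewrite big_ord0.
  have f0 (Q : 'M[R]_(m, 0)) : (0 <= (\det (gram t (row_mx Q B)) `^ (- s))%:E)%E.
    by rewrite lee_fin powR_ge0.
  apply: (etrans (ge0_integral_lebesgue_mx_transfer (@measurable_id _ _ setT) boxE mf f0)).
  by apply: (etrans E); rewrite diracT mul1e mul0r sub0r mul1r gram_row_mx mul0mx addr0.
have m1s : m.+1%:R / 2 <= s.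
  by apply: le_trans ms; rewrite ler_pM2r ?invr_gt0 // ler_nat addnS ltnS leq_addr.
have [K1 K10 HK1] := integral_gram_col m1s.
have [K K0 HK] : exists2 K : R, 0 < K & forall n t (B : 'M[R]_(m, n)), 0 < t ->
    (\int[@lebesgue_mx R m k]_Q (\det (gram t (row_mx Q B)) `^ (- (s - 2^-1)))%:E =
     (K * \det (gram t B) `^ (k%:R / 2 - (s - 2^-1)))%:E)%E.
  by apply: IH; move: ms; rewrite addnS -natr1; lra.
exists (K1 * K); first by rewrite mulr_gt0.
move=> n t B t0.
rewrite ge0_integral_lebesgue_mx_row_mx; last 2 first.
- apply/measurable_EFinP; apply: (measurableT_comp (measurable_det_gram _ _)).
  exact: measurable_row_mx.
- by move=> M; rewrite lee_fin powR_ge0.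
transitivity (\int[@lebesgue_mx R m k]_Q
    (K1%:E * (\det (gram t (row_mx Q B)) `^ (- (s - 2^-1)))%:E))%E.
  apply: eq_integral => Q _.
  rewrite -EFinM opprB -(HK1 _ _ _ t0).
  apply: eq_integral => u _; congr (\det _ `^ _)%:E; exact: (@gram_row_mxA m 1 k n).
rewrite ge0_integralZl //; first last.
- by rewrite lee_fin ltW.
- by move=> M _; rewrite lee_fin powR_ge0.
- apply/measurable_EFinP; apply: (measurableT_comp (measurable_det_gram _ _)).
  exact: measurable_row_mx.
rewrite HK // -EFinM mulrA; congr (_ * _ `^ _)%:E.
by rewrite -natr1; lra.
Qed.

Lemma ge0_integral_lebesgue_tuple_consC n (f : n.+1.-tuple R -> \bar R) :
  measurable_fun setT f -> (forall u, 0 <= f u)%E ->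
  (\int[lebesgue_tuple n.+1]_u f u =
   \int[@lebesgue_measure R]_x \int[lebesgue_tuple n]_u f (tcons (x, u)))%E.
Proof.
move=> mf f0; apply: (etrans (ge0_integral_lebesgue_tuple_cons mf f0)); apply: esym.
apply: (@fubini_tonelli _ _ _ _ _ (@lebesgue_measure R) (lebesgue_tuple n) (f \o @tcons R n)).
  exact: measurableT_comp mf (@measurable_tcons _ _).
by move=> x; exact: f0.
Qed.

(** The opposite order of integration, for a distinguished entry that lies in the first column. *)
Lemma ge0_integral_lebesgue_mx_row_mxC m n (f : 'M[R]_(m, 1 + n) -> \bar R) :
  measurable_fun setT f -> (forall M, 0 <= f M)%E ->
  (\int[@lebesgue_mx R m (1 + n)]_M f M =
   \int[lebesgue_tuple m]_u \int[@lebesgue_mx R m n]_Q f (row_mx (col_of_tuple u) Q))%E.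
Proof.
move=> mf f0; rewrite ge0_integral_lebesgue_mx_row_mx //.
rewrite -(fubini_tonelli (fun x => f (row_mx (col_of_tuple x.1) x.2))) //.
apply: (measurableT_comp mf); apply: measurable_row_mx => //.
exact: measurableT_comp (@measurable_col_of_tuple _) measurable_fst.
Qed.

(** All columns except the one with the distinguished entry are integrated out. [K] does not depend
    on [g], so that the mass, with g = 1, and the first moment, with g = |x|, can be compared. *)
Lemma integral_gram_entry m k (s : R) (i : 'I_m) (j : 'I_k.+1) :
  (m + k)%:R / 2 <= s ->
  exists2 K : R, 0 < K & forall t (g : R -> R), 0 < t ->
  measurable_fun setT g -> (forall x, 0 <= g x) ->
  (\int[@lebesgue_mx R m k.+1]_M (g (M i j) * \det (gram t M) `^ (- s))%:E =
   K%:E * \int[lebesgue_tuple m]_u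
     (g (tnth u i) * \det (gram t (col_of_tuple u)) `^ (k%:R / 2 - s))%:E)%E.
Proof.
have mgM n (i' : 'I_m) (j' : 'I_n) (g : R -> R) t s' : measurable_fun setT g ->
    measurable_fun setT (fun M : 'M[R]_(m, n) => (g (M i' j') * \det (gram t M) `^ s')%:E).
  move=> mg; apply/measurable_EFinP.
  apply: measurable_funM; last exact: measurable_det_gram.
  exact: measurableT_comp mg (measurable_entry _ _).
have g0M (g : R -> R) x y s' : (forall x, 0 <= g x) -> (0 <= (g x * y `^ s')%:E)%E.
  by move=> g0; rewrite lee_fin mulr_ge0 ?powR_ge0.
have first_col k' s' : (m + k')%:R / 2 <= s' ->
    exists2 K : R, 0 < K & forall t (g : R -> R), 0 < t ->
    measurable_fun setT g -> (forall x, 0 <= g x) ->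
    (\int[@lebesgue_mx R m (1 + k')]_M (g (M i (lshift k' ord0)) * \det (gram t M) `^ (- s'))%:E =
     K%:E * \int[lebesgue_tuple m]_u
       (g (tnth u i) * \det (gram t (col_of_tuple u)) `^ (k'%:R / 2 - s'))%:E)%E.
  move=> ms'; have [K K0 HK] := integral_gram_block ms'.
  exists K => // t g t0 mg g0.
  rewrite (ge0_integral_lebesgue_mx_row_mxC (mgM _ _ _ _ _ _ mg) (fun M => g0M _ _ _ _ g0)).
  rewrite -ge0_integralZl; first last.
  - by rewrite lee_fin ltW.
  - by move=> u _; exact: g0M.
  - apply/measurable_EFinP; apply: measurable_funM.
      exact: measurableT_comp mg (measurable_tnth _).
    exact: measurableT_comp (measurable_det_gram _ _) (@measurable_col_of_tuple _).
  - exact: measurableT.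
  apply: eq_integral => u _.
  transitivity (\int[@lebesgue_mx R m k']_Q
      ((g (tnth u i))%:E * (\det (gram t (row_mx Q (col_of_tuple u))) `^ (- s'))%:E))%E.
    apply: eq_integral => Q _.
    by rewrite row_mxEl mxE gram_row_mxC EFinM.
  rewrite ge0_integralZl; first last.
  - by rewrite lee_fin.
  - by move=> Q _; rewrite lee_fin powR_ge0.
  - apply/measurable_EFinP; apply: (measurableT_comp (measurable_det_gram _ _)).
    exact: measurable_row_mx.
  - exact: measurableT.
  by rewrite HK // -!EFinM mulrCA.
(* A first column without the distinguished entry is integrated out; once the entry lies in the
   first column, [first_col] integrates out the rest. *)
elim: k s j => [|k IH] s j ms; case: (unliftP ord0 j) => [j'|] {j} ->; first by case: j'.
- by have := first_col 0 s ms; rewrite (_ : lshift 0 ord0 = ord0) //; exact/val_inj.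
- have m1s : m.+1%:R / 2 <= s.
    by apply: le_trans ms; rewrite ler_pM2r ?invr_gt0 // ler_nat addnS ltnS leq_addr.
  have [K1 K10 HK1] := integral_gram_col m1s.
  have [|K K0 HK] := IH (s - 2^-1) j'.
    by move: ms; rewrite addnS -natr1; lra.
  exists (K1 * K); first by rewrite mulr_gt0.
  move=> t g t0 mg g0.
  rewrite (@ge0_integral_lebesgue_mx_row_mx _ m k.+1 _ (mgM _ _ _ _ _ _ mg) (fun M => g0M _ _ _ _ g0)).
  transitivity (\int[@lebesgue_mx R m k.+1]_Q
      (K1%:E * (g (Q i j') * \det (gram t Q) `^ (- (s - 2^-1)))%:E))%E.
    apply: eq_integral => Q _.
    transitivity (\int[lebesgue_tuple m]_u
        ((g (Q i j'))%:E * (\det (gram t (row_mx (col_of_tuple u) Q)) `^ (- s))%:E))%E.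
      apply: eq_integral => u _; rewrite -EFinM; congr (g _ * _)%:E.
      rewrite (_ : lift ord0 j' = rshift 1 j'); last exact/val_inj.
      exact: row_mxEr.
    rewrite ge0_integralZl; first last.
    - by rewrite lee_fin.
    - by move=> u _; rewrite lee_fin powR_ge0.
    - by apply/measurable_EFinP; exact: measurable_gram_col.
    - exact: measurableT.
    by rewrite HK1 // -!EFinM opprB mulrCA.
  rewrite ge0_integralZl; first last.
  - by rewrite lee_fin ltW.
  - by move=> Q _; exact: g0M.
  - exact: mgM.
  - exact: measurableT.
  rewrite HK // muleA -EFinM (_ : k%:R / 2 - (s - 2^-1) = k.+1%:R / 2 - s) //.
  by rewrite -natr1; lra.
- by have := first_col _ s ms; rewrite (_ : lshift k.+1 ord0 = ord0) //; exact/val_inj.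
Qed.

(** * Integrals over a single column *)

Definition sqsum n (u : n.-tuple R) : R := \sum_(i < n) tnth u i ^+ 2.

Lemma sqsum_cons n x (u : n.-tuple R) : sqsum (tcons (x, u)) = x ^+ 2 + sqsum u.
Proof.
by rewrite /sqsum big_ord_recl; congr (_ + _); apply: eq_bigr => i _; rewrite tnthS.
Qed.

(** For one column the Gram matrix is a rank one update of t I. *)
Lemma det_gram_col_of_tuple n t (u : n.+1.-tuple R) : 0 < t ->
  \det (gram t (col_of_tuple u)) = t ^+ n * (t + sqsum u).
Proof.
move=> t0; rewrite /gram.
have -> : col_of_tuple u *m (col_of_tuple u)^T =
    t%:M *m (t^-1 *: col_of_tuple u) *m (col_of_tuple u)^T.
  by rewrite mul_scalar_mx scalerA divff ?gt_eqF // scale1r.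
rewrite det_rank1_update det_scalar exprSr -mulrA; congr (_ * _).
rewrite -scalemxAr mxE -sqnorm_col sqnormE mulrDr mulr1 mulrA divff ?gt_eqF // mul1r.
by congr (_ + _); apply: eq_bigr => i _; rewrite big_ord1 mxE.
Qed.


Lemma measurable_sq_add (a s : R) :
  measurable_fun setT (fun x : R => (a + x ^+ 2) `^ s).
Proof.
rewrite (_ : (fun _ => _) = fun x : R => (1 * (x - 0) ^+ 2 + a) `^ s).
  exact: measurable_shifted_kernel.
by apply/funext => x; rewrite mul1r subr0 addrC.
Qed.

Lemma integral_sq_add (s a : R) : 1 <= s -> 0 < a ->
  (\int[@lebesgue_measure R]_x ((a + x ^+ 2) `^ (- s))%:E =
   (fine (student_mass s) * a `^ (2^-1 - s))%:E)%E.
Proof.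
move=> s1 a0.
transitivity (\int[@lebesgue_measure R]_x ((1 * (x - 0 : R) ^+ 2 + a) `^ (- s))%:E)%E.
  by apply: eq_integral => y _; rewrite mul1r subr0 addrC.
by rewrite integral_quadratic_powR // powR1 mul1r EFinM fineK // student_mass_fin.
Qed.

Let measurable_sqsum n (a s : R) :
  measurable_fun setT (fun u : n.-tuple R => (a + sqsum u) `^ s).
Proof.
apply: (measurableT_comp (measurable_powR _)); apply: measurable_funD => //.
apply: measurable_sum => i; apply: measurable_funX; exact: measurable_tnth.
Qed.

Let sqsum_ge0 n (u : n.-tuple R) : 0 <= sqsum u.
Proof. by apply: sumr_ge0 => i _; exact: sqr_ge0. Qed.

Lemma integral_sqsum m (s : R) : m.+1%:R / 2 <= s ->
  exists2 K : R, 0 < K & forall a, 0 < a ->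
  (\int[lebesgue_tuple m]_u ((a + sqsum u) `^ (- s))%:E =
   (K * a `^ (m%:R / 2 - s))%:E)%E.
Proof.
elim: m s => [|m IH] s ms.
  exists 1 => // a a0.
  have mf : measurable_fun setT (fun u : 0.-tuple R => ((a + sqsum u) `^ (- s))%:E).
    by apply/measurable_EFinP; exact: measurable_sqsum.
  have E := @integral_dirac _ _ ([tuple] : 0.-tuple R) R setT measurableT _ mf.
  by apply: etrans; [exact: E|rewrite diracT mul1e /sqsum big_ord0 addr0 mul0r sub0r mul1r].
have s1 : 1 <= s by apply: le_trans ms; rewrite ler_pdivlMr // mul1r ler_nat.
have [|K K0 HK] := IH (s - 2^-1); first by move: ms; rewrite -natr1; lra.
exists (fine (student_mass s) * K); first by rewrite mulr_gt0 ?fine_student_mass_gt0.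
move=> a a0.
rewrite ge0_integral_lebesgue_tuple_cons; first last.
- by move=> u; rewrite lee_fin powR_ge0.
- by apply/measurable_EFinP; exact: measurable_sqsum.
transitivity (\int[lebesgue_tuple m]_u
  ((fine (student_mass s))%:E * ((a + sqsum u) `^ (- (s - 2^-1)))%:E))%E.
  apply: eq_integral => u _.
  have au : 0 < a + sqsum u by rewrite ltr_pwDl.
  rewrite -EFinM opprB -(integral_sq_add s1 au).
  by apply: eq_integral => x _; rewrite sqsum_cons [x ^+ 2 + _]addrC addrA.
rewrite ge0_integralZl; first last.
- by rewrite lee_fin ltW ?fine_student_mass_gt0.
- by move=> u _; rewrite lee_fin powR_ge0.
- by apply/measurable_EFinP; exact: measurable_sqsum.
- exact: measurableT.
rewrite HK // -EFinM -mulrA (_ : m%:R / 2 - (s - 2^-1) = m.+1%:R / 2 - s) //.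
by rewrite -natr1; lra.
Qed.

(** The scheme of [integral_gram_entry], with coordinates in place of columns. *)
Lemma integral_sqsum_entry m (s : R) (i : 'I_m.+1) : m.+1%:R / 2 <= s ->
  exists2 K : R, 0 < K & forall a (g : R -> R), 0 < a ->
  measurable_fun setT g -> (forall x, 0 <= g x) ->
  (\int[lebesgue_tuple m.+1]_u (g (tnth u i) * (a + sqsum u) `^ (- s))%:E =
   K%:E * \int[@lebesgue_measure R]_x (g x * (a + x ^+ 2) `^ (m%:R / 2 - s))%:E)%E.
Proof.
have mgM n (i' : 'I_n) (g : R -> R) a s' : measurable_fun setT g ->
    measurable_fun setT (fun u : n.-tuple R => (g (tnth u i') * (a + sqsum u) `^ s')%:E).
  move=> mg; apply/measurable_EFinP; apply: measurable_funM; last exact: measurable_sqsum.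
  exact: measurableT_comp mg (measurable_tnth _).
have g0M (g : R -> R) x y s' : (forall x, 0 <= g x) -> (0 <= (g x * y `^ s')%:E)%E.
  by move=> g0; rewrite lee_fin mulr_ge0 ?powR_ge0.
have head n s' : n.+1%:R / 2 <= s' ->
    exists2 K : R, 0 < K & forall a (g : R -> R), 0 < a ->
    measurable_fun setT g -> (forall x, 0 <= g x) ->
    (\int[lebesgue_tuple n.+1]_u (g (tnth u ord0) * (a + sqsum u) `^ (- s'))%:E =
     K%:E * \int[@lebesgue_measure R]_x (g x * (a + x ^+ 2) `^ (n%:R / 2 - s'))%:E)%E.
  move=> ns; have [K K0 HK] := integral_sqsum ns.
  exists K => // a g a0 mg g0.
  have mf := mgM n.+1 ord0 g a (- s') mg.
  rewrite (ge0_integral_lebesgue_tuple_consC mf (fun u => g0M _ _ _ _ g0)).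
  rewrite -ge0_integralZl; first last.
  - by rewrite lee_fin ltW.
  - by move=> x _; exact: g0M.
  - by apply/measurable_EFinP; apply: measurable_funM; [exact: mg|exact: measurable_sq_add].
  - exact: measurableT.
  apply: eq_integral => x _.
  transitivity (\int[lebesgue_tuple n]_u
      ((g x)%:E * ((a + x ^+ 2 + sqsum u) `^ (- s'))%:E))%E.
    by apply: eq_integral => u _; rewrite sqsum_cons addrA EFinM.
  rewrite ge0_integralZl; first last.
  - by rewrite lee_fin.
  - by move=> u _; rewrite lee_fin powR_ge0.
  - by apply/measurable_EFinP; exact: measurable_sqsum.
  - exact: measurableT.
  by rewrite HK ?ltr_pwDl ?sqr_ge0 // -!EFinM mulrCA.
elim: m s i => [|m IH] s i ms; case: (unliftP ord0 i) => [i'|] {i} ->; first by case: i'.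
- exact: head.
- have s1 : 1 <= s by apply: le_trans ms; rewrite ler_pdivlMr // mul1r ler_nat.
  have [|K K0 HK] := IH (s - 2^-1) i'; first by move: ms; rewrite -natr1; lra.
  exists (fine (student_mass s) * K); first by rewrite mulr_gt0 ?fine_student_mass_gt0.
  move=> a g a0 mg g0.
  rewrite (ge0_integral_lebesgue_tuple_cons (mgM _ _ _ _ _ mg) (fun u => g0M _ _ _ _ g0)).
  transitivity (\int[lebesgue_tuple m.+1]_u
      ((fine (student_mass s))%:E * (g (tnth u i') * (a + sqsum u) `^ (- (s - 2^-1)))%:E))%E.
    apply: eq_integral => u _.
    transitivity (\int[@lebesgue_measure R]_x
        ((g (tnth u i'))%:E * ((a + sqsum u + x ^+ 2) `^ (- s))%:E))%E.
      apply: eq_integral => x _.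
      by rewrite -EFinM tnthS sqsum_cons [x ^+ 2 + _]addrC addrA.
    rewrite ge0_integralZl; first last.
    - by rewrite lee_fin.
    - by move=> x _; rewrite lee_fin powR_ge0.
    - by apply/measurable_EFinP; exact: measurable_sq_add.
    - exact: measurableT.
    by rewrite integral_sq_add ?ltr_pwDl // -!EFinM opprB mulrCA.
  rewrite ge0_integralZl; first last.
  - by rewrite lee_fin ltW ?fine_student_mass_gt0.
  - by move=> u _; exact: g0M.
  - exact: mgM.
  - exact: measurableT.
  rewrite HK // muleA -EFinM (_ : m%:R / 2 - (s - 2^-1) = m.+1%:R / 2 - s) //.
  by rewrite -natr1; lra.
- exact: head.
Qed.

(** In absolute value the exponent starts at d1 / 2 + d2 / 2 + 2. The [d2] other columns and the
    [d1] other entries of the column each lower it by 1/2 when integrated out, which leaves 2. *)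
Lemma integral_student_entry (d1 d2 : nat) (t : R) (i : 'I_d1.+1) (j : 'I_d2.+1) : 0 < t ->
  exists2 K : R, 0 < K & forall g : R -> R,
  measurable_fun setT g -> (forall x, 0 <= g x) ->
  (\int[@lebesgue_mx R d1.+1 d2.+1]_M
     (g (M i j) * \det (gram t M) `^ (- ((d1.+1 + d2.+1 + 2)%:R / 2)))%:E =
   K%:E * \int[@lebesgue_measure R]_x (g x * (t + x ^+ 2) `^ (- 2))%:E)%E.
Proof.
move=> t0; set s : R := (_ / 2).
have sE : s = d1%:R / 2 + d2%:R / 2 + 2.
  by rewrite /s !natrD -!natr1; field.
have d10 : 0 <= d1%:R :> R by []. have d20 : 0 <= d2%:R :> R by [].
have [|K1 K10 HK1] := @integral_gram_entry d1.+1 d2 s i j.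
  by rewrite sE natrD -natr1; lra.
have [|K2 K20 HK2] := @integral_sqsum_entry d1 (s - d2%:R / 2) i.
  by rewrite sE -natr1; lra.
(* The contribution of the factor t^d1 in the determinant for one column. *)
pose c : R := (t ^+ d1) `^ (d2%:R / 2 - s).
have c0 : 0 < c by rewrite powR_gt0 // exprn_gt0.
exists (K1 * (c * K2)); first by rewrite !mulr_gt0.
move=> g mg g0; rewrite HK1 // EFinM -muleA; congr (_ * _)%E.
transitivity (\int[lebesgue_tuple d1.+1]_u
    (c%:E * (g (tnth u i) * (t + sqsum u) `^ (- (s - d2%:R / 2)))%:E))%E.
  apply: eq_integral => u _; rewrite -EFinM; congr EFin.
  have tu : 0 <= t + sqsum u by rewrite addr_ge0 // ltW.
  rewrite det_gram_col_of_tuple // (powRM _ (exprn_ge0 _ (ltW t0)) tu) opprB /c.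
  by rewrite mulrCA.
rewrite ge0_integralZl; first last.
- by rewrite lee_fin ltW.
- by move=> u _; rewrite lee_fin mulr_ge0 ?g0 ?powR_ge0.
- apply/measurable_EFinP; apply: measurable_funM; last exact: measurable_sqsum.
  exact: measurableT_comp mg (measurable_tnth _).
- exact: measurableT.
rewrite HK2 // muleA -EFinM; congr (_ * _)%E.
apply: eq_integral => x _; congr (_ * _ `^ _)%:E; rewrite sE; lra.
Qed.

End gram_integral.

(** * Densities and the spectral Student prior *)

Section density_integral.
Local Open Scope ereal_scope.
Context d (T : measurableType d) (R : realType).
Variables (mu : {measure set T -> \bar R}) (w : T -> R).
Hypotheses (w0 : forall x, (0 <= w x)%R) (mw : measurable_fun [set: T] w).
Local Notation nu := (density_measure mu w0 mw).

Import HBNNSimple.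

(** The formula holds for simple functions by additivity and passes to the limit by monotone
    convergence. *)
Lemma ge0_integral_density (f : T -> \bar R) :
  measurable_fun setT f -> (forall x, 0 <= f x) ->
  \int[nu]_x f x = \int[mu]_x (f x * (w x)%:E).
Proof.
move=> mf f0.
pose h := nnsfun_approx measurableT mf.
have fE x : f x = limn (EFin \o h ^~ x).
  by apply/esym/cvg_lim => //; exact: cvg_nnsfun_approx.
have hS (n : nat) : \int[nu]_x (h n x)%:E = \int[mu]_x ((h n x)%:E * (w x)%:E).
  have hE x : (h n x)%:E = \sum_(r \in range (h n)) (r * \1_(h n @^-1` [set r]) x)%:E.
    by rewrite fimfunE -fsumEFin.
  transitivity (\int[nu]_x \sum_(r \in range (h n)) (r * \1_(h n @^-1` [set r]) x)%:E).
    by apply: eq_integral => x _.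
  rewrite ge0_integral_fsum//; last 2 first.
  - by move=> y; exact/measurable_EFinP/measurable_funM.
  - by move=> y x _; rewrite nnfun_muleindic_ge0.
  transitivity (\sum_(r \in range (h n)) \int[mu]_x ((r * \1_(h n @^-1` [set r]) x)%:E * (w x)%:E)).
    apply: eq_fsbigr => r; rewrite inE => -[y _ <-].
    rewrite integralZl_indic_nnsfun// integral_indic// setIT /= /density_measure.
    rewrite integral_mkcond -ge0_integralZl //; first last.
    - by rewrite lee_fin.
    - by move=> x _; rewrite erestrict_ge0 // => z _; rewrite lee_fin.
    - apply/(measurable_restrictT _ _).1 => //.
      by apply: measurable_funTS; exact/measurable_EFinP.
    apply: eq_integral => x _; rewrite patchE indicE.
    by case: ifPn => _ /=; rewrite ?mulr1 // mulr0 mul0e mule0.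
  rewrite -ge0_integral_fsum//; last 2 first.
  - move=> r; apply: emeasurable_funM; last exact/measurable_EFinP.
    exact/measurable_EFinP/measurable_funM.
  - by move=> r x _; rewrite mule_ge0 ?nnfun_muleindic_ge0 ?lee_fin.
  apply: eq_integral => x _; rewrite hE ge0_mule_fsuml // => r.
  exact: nnfun_muleindic_ge0.
transitivity (limn (fun n => \int[nu]_x (h n x)%:E)).
  rewrite -monotone_convergence//.
  - by apply: eq_integral => x _; exact: fE.
  - by move=> n; exact/measurable_EFinP.
  - by move=> n x _; rewrite lee_fin.
  - by move=> x _ a b ab; rewrite lee_fin; exact/lefP/nd_nnsfun_approx.
rewrite (_ : (fun n => _) = fun n => \int[mu]_x ((h n x)%:E * (w x)%:E)); last exact/funext.
rewrite -monotone_convergence//.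
- apply: eq_integral => x _; apply/cvg_lim => //.
  apply: cvgeZr => //; exact: cvg_nnsfun_approx.
- move=> n; apply: emeasurable_funM; exact/measurable_EFinP.
- by move=> n x _; rewrite mule_ge0 ?lee_fin.
- move=> x _ a b ab; rewrite lee_wpmul2r ?lee_fin //; exact/lefP/nd_nnsfun_approx.
Qed.

(** The mass [Z] is positive and finite, so [mnormalize] divides by it and does not fall back on
    [P]. *)
Lemma ge0_integral_mnormalize_density (P : probability T R) (Z : R) (f : T -> \bar R) :
  (0 < Z)%R -> \int[mu]_x (w x)%:E = Z%:E ->
  measurable_fun setT f -> (forall x, 0 <= f x) ->
  \int[mnormalize nu P]_x f x = (Z^-1)%:E * \int[mu]_x (f x * (w x)%:E).
Proof.
move=> Z0 wZ mf f0.
have nuT : (nu : {measure set T -> \bar R}) setT = Z%:E by [].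
have nE A : mnormalize nu P A = (Z^-1)%:E * nu A.
  by rewrite /mnormalize nuT eqe gt_eqF //= muleC.
have Zi : (0 <= Z^-1)%R by rewrite invr_ge0 ltW.
transitivity (\int[mscale (NngNum Zi) nu]_x f x).
  by apply: eq_measure_integral => A mA _; exact: nE.
by rewrite ge0_integral_mscale //; congr (_ * _); exact: ge0_integral_density.
Qed.

End density_integral.

(** * Mass and first moments of the spectral Student prior *)

Section student_prior_integral.
Context {R : realType} {d1 d2 : nat}.
Local Notation mat := 'M[R]_(d1.+1, d2.+1).
Implicit Types tau : R.

Lemma student_weightE tau (M : mat) :
  student_weight tau M = \det (gram (tau ^+ 2) M) `^ (- ((d1.+1 + d2.+1 + 2)%:R / 2)).
Proof. by []. Qed.

(** The question is one-dimensional by [integral_student_entry]. As 2 tau |x| <= tau^2 + x^2, the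
    function |x| (tau^2 + x^2)^-2 is at most (2 tau)^-1 (tau^2 + x^2)^-1, so the ratio of first
    moment to mass is at most tau / 2 times the ratio of [student_mass 1] to [student_mass 2], hence
    at most 4 tau. *)
Lemma integral_student_weight tau : 0 < tau ->
  exists2 Z : R, 0 < Z &
    (\int[@lebesgue_mx R d1.+1 d2.+1]_M (student_weight tau M)%:E = Z%:E)%E /\
    forall i j, (\int[@lebesgue_mx R d1.+1 d2.+1]_M (`|M i j| * student_weight tau M)%:E
      <= (4 * tau * Z)%:E)%E.
Proof.
move=> tau0; have t0 : 0 < tau ^+ 2 by rewrite exprn_gt0.
have kE s : 1 <= s -> (\int[@lebesgue_measure R]_x ((tau ^+ 2 + x ^+ 2) `^ (- s))%:E =
    (fine (student_mass s) * tau `^ (1 - 2 * s))%:E)%E.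
  move=> s1; rewrite integral_sq_add //; congr (_ * _)%:E.
  by rewrite -powR_mulrn ?ltW // -powRrM; congr (_ `^ _); lra.
have massE i j : exists2 K : R, 0 < K &
  (\int[@lebesgue_mx R d1.+1 d2.+1]_M (student_weight tau M)%:E =
    (K * (fine (student_mass 2) * tau `^ (- 3)))%:E)%E /\
  (\int[@lebesgue_mx R d1.+1 d2.+1]_M (`|M i j| * student_weight tau M)%:E
      <= (4 * tau * (K * (fine (student_mass 2) * tau `^ (- 3))))%:E)%E.
  have [K K0 HK] := integral_student_entry i j t0.
  exists K => //; split.
    have := HK (fun=> 1) (measurable_cst _) (fun=> ler01).
    under eq_integral do rewrite mul1r -student_weightE.
    move=> ->; under eq_integral do rewrite mul1r.
    rewrite kE ?ler1n // -EFinM; congr (_ * (_ * _ `^ _))%:E; lra.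
  have mnorm : measurable_fun setT (fun x : R => `|x|) by exact: normr_measurable.
  have := HK (fun x => `|x|) mnorm (fun x => normr_ge0 x).
  under eq_integral do rewrite -student_weightE.
  move=> ->; rewrite mulrCA EFinM lee_pmul2l // ?lte_fin //.
  apply: (@le_trans _ _ (\int[@lebesgue_measure R]_x
    ((2 * tau)^-1%:E * ((tau ^+ 2 + x ^+ 2) `^ (- 1))%:E))%E).
    apply: ge0_le_integral.
    - exact: measurableT.
    - by move=> x _; rewrite lee_fin mulr_ge0 ?powR_ge0.
    - by apply/measurable_EFinP; apply: measurable_funM; [exact: mnorm|exact: measurable_sq_add].
    - by apply: emeasurable_funM => //; apply/measurable_EFinP; exact: measurable_sq_add.
    - move=> x _; rewrite -EFinM lee_fin.
      have k0 : 0 < tau ^+ 2 + x ^+ 2 by rewrite ltr_pwDl ?sqr_ge0.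
      rewrite (powR_invn _ (ltW k0)) (powR_inv1 (ltW k0)); set k := _ + _ in k0 *.
      rewrite [leRHS](_ : _ = k / (2 * tau) * k ^- 2); last by field; rewrite !gt_eqF.
      rewrite ler_wpM2r ?invr_ge0 ?exprn_ge0 ?(ltW k0) // ler_pdivlMr ?mulr_gt0 // /k.
      by have := sqr_ge0 (tau - `|x|); rewrite -(real_normK (num_real x)); nra.
  rewrite ge0_integralZl; first last.
  - by rewrite lee_fin invr_ge0 mulr_ge0 // ltW.
  - by move=> x _; rewrite lee_fin powR_ge0.
  - by apply/measurable_EFinP; exact: measurable_sq_add.
  - exact: measurableT.
  rewrite kE // -EFinM lee_fin.
  have c12 : fine (student_mass 1) <= 8 * fine (student_mass 2) :> R.
    by rewrite -lee_fin EFinM !fineK ?student_mass_fin ?ler1n // student_mass1_le.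
  rewrite (_ : 1 - 2 * 1 = - 1 :> R); last by ring.
  rewrite (powR_inv1 (ltW tau0)) (powR_invn _ (ltW tau0)).
  rewrite (_ : (2 * tau)^-1 * _ = fine (student_mass 1) * (tau ^- 2 / 2)); last first.
    by field; rewrite gt_eqF.
  rewrite (_ : 4 * tau * _ = 8 * fine (student_mass 2) * (tau ^- 2 / 2)); last first.
    by field; rewrite gt_eqF.
  by rewrite ler_wpM2r // divr_ge0 // invr_ge0 exprn_ge0 // ltW.
(* [K] may vary with the entry, but its product with the one-dimensional mass is the total mass,
   which does not; the entry (0, 0) is used to name it. *)
have [K K0 [E1 _]] := massE ord0 ord0.
exists (K * (fine (student_mass 2) * tau `^ (- 3))).
  by rewrite !mulr_gt0 ?powR_gt0 ?fine_student_mass_gt0 ?ler1n.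
split => // i j; have [K' K'0 [E1' E2']] := massE i j.
by move: E1' E2'; rewrite E1 => -[->].
Qed.

End student_prior_integral.

(** * The law of one observation *)

Section finite_integral.
Local Open Scope ereal_scope.
Context d (T : measurableType d) (R : realType).
Variables (mu : {measure set T -> \bar R}) (s : seq T).
Hypotheses (us : uniq s) (sT : forall x, x \in s).
Hypothesis mT : forall A : set T, measurable A.

Lemma ge0_integral_finite (f : T -> \bar R) : (forall x, 0 <= f x) ->
  \int[mu]_x f x = \sum_(x <- s) f x * mu [set x].
Proof.
move=> f0.
have TE : [set: T] = \big[setU/set0]_(x <- s) [set x].
  apply/esym; rewrite -subTset => x _; rewrite -bigcup_seq; exists x => //=.
rewrite TE ge0_integral_bigsetU //; last by move=> i j _ _ [x [-> ->]].
apply: eq_bigr => x _.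
rewrite (eq_integral (cst (f x))); last by move=> y; rewrite inE => ->.
by rewrite integral_cst.
Qed.

End finite_integral.

Section observation_law.
Context {R : realType} {d1 d2 : nat}.
Local Notation mat := 'M[R]_(d1.+1, d2.+1).
Local Notation entry := ('I_d1.+1 * 'I_d2.+1)%type.
Local Notation obs := (entry * bool)%type.
Variable Pi : probability entry R.
Implicit Types (M : mat) (o : obs).

Lemma measurable_obs_set (A : set obs) : measurable A.
Proof.
rewrite (_ : A = \bigcup_(o in A) [set o]); last first.
  by apply/seteqP; split => [w Aw|w [v Av ->]] //; exists w.
apply: fin_bigcup_measurable; first exact: finite_finset.
move=> [w b] _; rewrite (_ : [set _] = [set w] `*` [set b]).
  by apply: measurableX => //; exact: measurable_entry_set.
by apply/seteqP; split => [[a c] [-> ->]|[a c] /= [-> ->]].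
Qed.

Lemma ge0_integral_obs (mu : {measure set obs -> \bar R}) (f : obs -> \bar R) :
  (forall o, 0 <= f o)%E ->
  (\int[mu]_o f o = \sum_(o : obs) f o * mu [set o])%E.
Proof.
move=> f0; apply: ge0_integral_finite => //.
- exact: index_enum_uniq.
- by move=> x; exact: mem_index_enum.
- exact: measurable_obs_set.
Qed.

(** One factor of [likelihood], in the same form, so that [likelihoodE] holds by conversion. *)
Definition lik M o : R := logistic (M o.1.1 o.1.2) ^+ o.2 *
  (1 - logistic (M o.1.1 o.1.2)) ^+ (~~ o.2).

Definition entry_mass (w : entry) : R := fine (Pi [set w]).

Lemma onem_logistic_gt0 (x : R) : 0 < 1 - logistic x.
Proof. by rewrite onem_logistic invr_gt0 addr_gt0 ?expR_gt0. Qed.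

Lemma lik_gt0 M o : 0 < lik M o.
Proof. by rewrite mulr_gt0 ?exprn_gt0 ?logistic_gt0 ?onem_logistic_gt0. Qed.

Lemma entry_mass_ge0 w : 0 <= entry_mass w.
Proof. exact: fine_ge0. Qed.

Lemma entry_massE w : Pi [set w] = (entry_mass w)%:E.
Proof. by rewrite fineK // fin_num_measure //; exact: measurable_entry_set. Qed.

Lemma obs_law1 M o : obs_law Pi M [set o] = (entry_mass o.1 * lik M o)%:E.
Proof.
case: o => w b; rewrite /obs_law.
rewrite (@ge0_integral_finite _ _ _ _ (index_enum entry)); first last.
- by move=> w' ; exact: measure_ge0.
- exact: measurable_entry_set.
- by move=> x; exact: mem_index_enum.
- exact: index_enum_uniq.
have p01 (x : R) : 0 <= logistic x <= 1.
  by rewrite ltW ?logistic_gt0 //= -subr_ge0 ltW ?onem_logistic_gt0.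
rewrite (bigD1 w) //= big1 ?adde0.
  rewrite entry_massE (_ : xsection _ _ = [set b]).
    rewrite bernoulli_probE // !diracE /lik /= [RHS]EFinM [RHS]muleC; congr (_ * _)%E.
    by case: b; rewrite !in_set1 /= !(mule1, mule0) ?adde0 ?add0e expr1 expr0 ?mulr1 ?mul1r.
  by apply/seteqP; split => c; rewrite /xsection /= inE; [case|move=> ->].
move=> w' ww'; rewrite (_ : xsection _ _ = set0) ?measure0 ?mul0e //.
by apply/seteqP; split => c //; rewrite /xsection /= inE => -[/eqP]; rewrite (negbTE ww').
Qed.

Lemma sum_obs_mass M : \sum_(o : obs) entry_mass o.1 * lik M o = 1.
Proof.
apply: EFin_inj; rewrite -sumEFin -[RHS](probability_setT (obs_law Pi M)).
rewrite -[RHS]mul1e -[RHS]integral_cst // ge0_integral_obs //.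
by apply: eq_bigr => o _; rewrite mul1e -obs_law1.
Qed.

(* The Hellinger integral [\int p_M^alpha p_M0^(1 - alpha)]. *)
Definition hellinger (alpha : R) (M0 M : mat) : R :=
  \sum_(o : obs) entry_mass o.1 * (lik M o `^ alpha * lik M0 o `^ (1 - alpha)).

(** * Renyi divergence between two observation laws *)

Section renyi.
Variables (alpha : R) (M0 : mat).
Hypotheses (alpha_gt0 : 0 < alpha) (alpha_lt1 : alpha < 1).

(** A vanishing sum of nonnegative terms would force every entry mass to be 0, while the total mass
    is 1. *)
Lemma hellinger_gt0 M : 0 < hellinger alpha M0 M.
Proof.
have t0 o : 0 < lik M o `^ alpha * lik M0 o `^ (1 - alpha).
  by rewrite mulr_gt0 ?powR_gt0 ?lik_gt0.
have ge0 o : 0 <= entry_mass o.1 * (lik M o `^ alpha * lik M0 o `^ (1 - alpha)).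
  by rewrite mulr_ge0 ?entry_mass_ge0 // ltW.
rewrite lt_def sumr_ge0 // andbT; apply/eqP => /eqP; rewrite psumr_eq0 // => /allP H.
have := sum_obs_mass M; rewrite big1 => [/eqP|o _]; first by rewrite eq_sym oner_eq0.
have /implyP/(_ isT) := H o (mem_index_enum _).
by rewrite mulf_eq0 (gt_eqF (t0 o)) orbF => /eqP ->; rewrite mul0r.
Qed.

(** The weighted arithmetic-geometric mean inequality for each observation, from the tangent of the
    exponential at the weighted mean [m] of the logarithms. *)
Lemma hellinger_le1 M : hellinger alpha M0 M <= 1.
Proof.
rewrite -(_ : \sum_(o : obs) entry_mass o.1 * (alpha * lik M o + (1 - alpha) * lik M0 o) = 1).
  apply: ler_sum => o _; rewrite ler_wpM2l ?entry_mass_ge0 //.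
  have := lik_gt0 M o; have := lik_gt0 M0 o.
  move: (lik M o) (lik M0 o) => a b b0 a0.
  rewrite /powR !gt_eqF // -expRD; set m := _ + _.
  have tangent c : 0 < c -> expR m * (1 + (ln c - m)) <= c.
    move=> c0; apply: le_trans (_ : expR m * expR (ln c - m) <= c).
      by rewrite ler_wpM2l ?expR_ge0 // expR_ge1Dx.
    by rewrite -expRD subrKC lnK.
  have ea := tangent a a0; have eb := tangent b b0.
  have a1 : 0 <= 1 - alpha by rewrite subr_ge0 ltW.
  have := lerD (ler_wpM2l (ltW alpha_gt0) ea) (ler_wpM2l a1 eb).
  by apply: le_trans; rewrite le_eqVlt; apply/orP; left; apply/eqP; rewrite /m; ring.
under eq_bigr do rewrite mulrDr [X in X + _]mulrCA [X in _ + X]mulrCA.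
rewrite big_split /= -[X in X + _]mulr_sumr -[X in _ + X]mulr_sumr !sum_obs_mass; ring.
Qed.

(** On a finite space the density at an atom of positive mass is a ratio of masses, here l / (l +
    l0) and l0 / (l + l0); the entry mass cancels. *)
Lemma renyi_divergenceE M :
  renyi_divergence (obs_law Pi M) (obs_law Pi M0) alpha =
  ((alpha - 1)^-1 * ln (hellinger alpha M0 M))%:E.
Proof.
rewrite /renyi_divergence.
rewrite (_ : (\int[_]_x _)%E = (hellinger alpha M0 M)%:E).
  by rewrite lne_EFin // hellinger_gt0.
rewrite ge0_integral_obs; last by move=> o; rewrite mule_ge0 // poweR_ge0.
rewrite /hellinger -sumEFin; apply: eq_bigr => o _.
have SE : sum_measure (obs_law Pi M) (obs_law Pi M0) [set o] =
    (entry_mass o.1 * (lik M o + lik M0 o))%:E.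
  by rewrite /sum_measure measure_addE mulrDr EFinD; congr (_ + _)%E; exact: obs_law1.
have densE (nu : probability obs R) :
    charge_of_finite_measure nu `<< sum_measure (obs_law Pi M) (obs_law Pi M0) ->
    (Radon_Nikodym (charge_of_finite_measure nu)
       (sum_measure (obs_law Pi M) (obs_law Pi M0)) o *
     (entry_mass o.1 * (lik M o + lik M0 o))%:E)%E = nu [set o].
  move=> nuS; rewrite -SE.
  have := Radon_Nikodym_integral nuS (measurable_obs_set [set o]).
  rewrite /= => ->; rewrite (eq_integral (cst (Radon_Nikodym (charge_of_finite_measure nu)
    (sum_measure (obs_law Pi M) (obs_law Pi M0)) o))) ?integral_cst //.
    exact: measurable_obs_set.
  by move=> x; rewrite inE => ->.
rewrite [X in (_ * X)%E](_ : _ = (entry_mass o.1 * (lik M o + lik M0 o))%:E); last exact: SE.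
have := etrans (densE _ (@dominates_sum_measurel _ _ _ (obs_law Pi M) (obs_law Pi M0)))
  (obs_law1 M o).
have := etrans (densE _ (@dominates_sum_measurer _ _ _ (obs_law Pi M) (obs_law Pi M0)))
  (obs_law1 M0 o).
have := Radon_Nikodym_fin_num o (@dominates_sum_measurel _ _ _ (obs_law Pi M) (obs_law Pi M0)).
have := Radon_Nikodym_fin_num o (@dominates_sum_measurer _ _ _ (obs_law Pi M) (obs_law Pi M0)).
move=> /EFin_fin_numP[p ->] /EFin_fin_numP[q ->].
have := lik_gt0 M o; have := lik_gt0 M0 o; have := entry_mass_ge0 o.1.
(* At an atom of mass 0 the densities are not determined, but both sides are 0. *)
move: (entry_mass o.1) (lik M0 o) (lik M o) => m l0 l; rewrite le_eqVlt => /predU1P[<-|m0].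
  by move=> *; rewrite !mul0r mule0.
move=> l00 lgt0; rewrite -!EFinM => -[pE] -[qE]; congr EFin.
have L0 : 0 < l + l0 by rewrite addr_gt0.
have -> : p = l0 * (l + l0)^-1.
  by apply: (mulIf (lt0r_neq0 (mulr_gt0 m0 L0))); rewrite pE; field; rewrite gt_eqF.
have -> : q = l * (l + l0)^-1.
  by apply: (mulIf (lt0r_neq0 (mulr_gt0 m0 L0))); rewrite qE; field; rewrite gt_eqF.
rewrite !powRM ?invr_ge0 ?ltW //.
have LL : (l + l0)^-1 `^ alpha * (l + l0)^-1 `^ (1 - alpha) = (l + l0)^-1.
  rewrite -powRD ?subrKC ?powRr1 ?invr_ge0 ?(ltW L0) //.
  by rewrite (gt_eqF (_ : 0 < (l + l0)^-1)) ?implybT // invr_gt0.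
rewrite [X in X * _]mulrACA LL; field.
by rewrite gt_eqF.
Qed.

End renyi.

End observation_law.

(** * Lower bound on the evidence *)

Section evidence.
Context {R : realType} {d1 d2 : nat}.
Local Notation mat := 'M[R]_(d1.+1, d2.+1).
Local Notation entry := ('I_d1.+1 * 'I_d2.+1)%type.
Local Notation obs := (entry * bool)%type.
Implicit Types (M N : mat) (o : obs).

Lemma ge0_integral_student_prior (tau Z : R) (f : mat -> \bar R) : 0 < Z ->
  (\int[@lebesgue_mx R d1.+1 d2.+1]_M (student_weight tau M)%:E = Z%:E)%E ->
  measurable_fun setT f -> (forall M, 0 <= f M)%E ->
  (\int[student_prior tau]_M f M =
   (Z^-1)%:E * \int[@lebesgue_mx R d1.+1 d2.+1]_M (f M * (student_weight tau M)%:E))%E.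
Proof. exact: ge0_integral_mnormalize_density. Qed.

(** The 1-Lipschitz property of log f and log (1 - f), in multiplicative form. With a = exp (- |h|)
    and b = exp h, it rests on a <= 1, a <= b and a b <= 1. *)
Lemma lik_addmx_ge M N o : lik M o * expR (- `|N o.1.1 o.1.2|) <= lik (M + N) o.
Proof.
rewrite /lik mxE; move: (M _ _) (N _ _) => x h.
have e1 : expR (- `|h|) <= 1 by rewrite expR_le1 oppr_le0.
have eh : expR (- `|h|) <= expR h by rewrite ler_expR lerNl -normrN ler_norm.
have eh1 : expR (- `|h|) * expR h <= 1.
  by rewrite -expRD expR_le1 addrC subr_le0 ler_norm.
have x0 := expR_gt0 x; have h0 := expR_gt0 h.
have d0 : 0 < 1 + expR x by rewrite addr_gt0.
have d0' : 0 < 1 + expR x * expR h by rewrite addr_gt0 ?mulr_gt0.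
rewrite !onem_logistic /logistic expRD.
move: (expR (- `|h|)) (expR h) (expR x) e1 eh eh1 x0 h0 d0 d0' => a b c e1 eh eh1 c0 b0 d0 d0'.
case: o.2; rewrite /= !expr1 !expr0 ?mulr1 ?mul1r.
  rewrite ler_pdivlMr // (_ : _ * (1 + c * b) = c * (a * (1 + c * b)) / (1 + c)); last first.
    by field; rewrite gt_eqF.
  rewrite ler_pdivrMr // -mulrA ler_pM2l // !mulrDr !mulr1 lerD // mulrCA mulrC ler_pM2r //.
  by rewrite ler_piMl // ltW.
rewrite -[leRHS]mul1r ler_pdivlMr // -mulrA ler_pdivrMl // mulr1 mulrDr mulr1 lerD //.
by rewrite mulrCA ler_piMr // ltW.
Qed.

Lemma likelihoodE n (z : 'I_n -> obs) M : likelihood z M = \prod_(s < n) lik M (z s).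
Proof. by []. Qed.

Lemma likelihood_gt0 n (z : 'I_n -> obs) M : 0 < likelihood z M.
Proof. by rewrite likelihoodE prodr_gt0 // => s _; exact: lik_gt0. Qed.

Lemma lik_le1 M o : lik M o <= 1.
Proof.
rewrite /lik; have := logistic_gt0 (M o.1.1 o.1.2); have := onem_logistic_gt0 (M o.1.1 o.1.2).
by case: o.2; rewrite /= ?expr0 ?expr1 ?mulr1 ?mul1r; lra.
Qed.

Lemma likelihood_le1 n (z : 'I_n -> obs) M : likelihood z M <= 1.
Proof.
rewrite likelihoodE; apply: prodr_ile1 => s _.
by rewrite lik_le1 andbT ltW ?lik_gt0.
Qed.

Lemma likelihood_addmx_ge n (z : 'I_n -> obs) M N :
  likelihood z M * expR (- \sum_(s < n) `|N (z s).1.1 (z s).1.2|) <= likelihood z (M + N).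
Proof.
rewrite !likelihoodE -sumrN expR_sum -big_split /=.
apply: ler_prod => s _; rewrite lik_addmx_ge andbT.
by rewrite mulr_ge0 ?expR_ge0 // ltW ?lik_gt0.
Qed.

(** [det_gram_add_le] with t = n^-2, raised to the power - [p]. *)
Lemma student_weight_shift_ge n M N : (0 < n)%N -> M != 0 ->
  expR (- (n%:R * rate n M)) * student_weight n%:R^-1 N <= student_weight n%:R^-1 (N + M).
Proof.
move=> n0 M0; have nR : 0 < n%:R :> R by rewrite ltr0n.
have t0 : 0 < n%:R^-1 ^+ 2 :> R by rewrite exprn_gt0 ?invr_gt0.
rewrite !student_weightE !powRN; set p : R := _ / 2.
have p0 : 0 <= p by rewrite divr_ge0.
have := det_gram_add_le N t0 M0.
set l := ln _ => le_det.
(* The factor 4 r times [p] is 2 r times [d1.+1 + d2.+1 + 2], and 1 / tau = n turns the square root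
   into the quotient that occurs in [rate]. *)
have lE : n%:R * rate n M = 4 * (\rank M)%:R * l * p.
  rewrite /rate /l.
  have -> : Num.sqrt (sqnorm M / (2 * (\rank M)%:R * n%:R^-1 ^+ 2)) =
      n%:R * frobenius_norm M / Num.sqrt (2 * (\rank M)%:R).
    rewrite (_ : _ / _ = n%:R ^+ 2 * (sqnorm M / (2 * (\rank M)%:R))); last first.
      have r0 : (\rank M)%:R != 0 :> R by rewrite pnatr_eq0 mxrank_eq0.
      by field; rewrite (lt0r_neq0 nR) r0.
    rewrite sqrtrM ?exprn_ge0 // sqrtr_sqr ger0_norm // sqrtrM ?sqnorm_ge0 // sqrtrV ?mulr_ge0 //.
    by rewrite mulrA sqnormE.
  by rewrite /p; field; rewrite gt_eqF.
rewrite lE expRN -invfM lef_pV2 ?posrE ?mulr_gt0 ?expR_gt0 ?powR_gt0 ?det_gram_gt0 //.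
apply: le_trans (ge0_ler_powR p0 _ _ le_det) _; rewrite ?nnegrE ?mulr_ge0 ?expR_ge0 ?(ltW (det_gram_gt0 _ t0)) //.
by rewrite powRM ?expR_ge0 ?(ltW (det_gram_gt0 _ t0)) // -expRM.
Qed.

Lemma measurable_likelihood_powR n (z : 'I_n -> obs) (a : R) :
  measurable_fun [set: mat] (fun M => likelihood z M `^ a).
Proof. by apply: (measurableT_comp (measurable_powR _)); exact: measurable_likelihood. Qed.

(** The tangent of exp (- y) at c. Being linear in y, it gives Jensen's inequality directly for the
    unnormalised weight. *)
Let exp_tangent (c y : R) : expR (- c) * (1 + c) <= expR (- y) + expR (- c) * y.
Proof.
rewrite -lerBlDr -mulrBr.
have := expR_ge1Dx (c - y); move=> /(ler_wpM2l (expR_ge0 (- c))).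
by rewrite -expRD addKr addrA.
Qed.

(** After the translation by [M0], the weight loses at most the factor exp (- n [rate]) and the
    likelihood power at most exp (- alpha [S N]). The prior mean of [S] is at most 4, and convexity
    of the exponential moves this mean into the exponent. *)
Lemma evidence_ge n (z : 'I_n -> obs) (alpha : R) M0 : (0 < n)%N -> 0 < alpha -> M0 != 0 ->
  ((likelihood z M0 `^ alpha * expR (- (n%:R * rate n M0 + 4 * alpha)))%:E <=
   \int[student_prior n%:R^-1]_M (likelihood z M `^ alpha)%:E)%E.
Proof.
move=> n0 a0 M00; have nR : 0 < n%:R :> R by rewrite ltr0n.
have tau0 : 0 < n%:R^-1 :> R by rewrite invr_gt0.
have [Z Z0 [ZE momE]] := @integral_student_weight R d1 d2 _ tau0.
rewrite (ge0_integral_student_prior Z0 ZE); last 2 first.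
- by apply/measurable_EFinP; exact: measurable_likelihood_powR.
- by move=> M; rewrite lee_fin powR_ge0.
rewrite (ge0_integral_lebesgue_mx_shift M0); last 2 first.
- apply: emeasurable_funM; apply/measurable_EFinP.
    exact: measurable_likelihood_powR.
  exact: measurable_student_weight.
- by move=> M; rewrite mule_ge0 ?lee_fin ?powR_ge0.
rewrite lee_pdivlMl //.
pose S N : R := \sum_(s < n) `|N (z s).1.1 (z s).1.2|.
pose C : R := likelihood z M0 `^ alpha * expR (- (n%:R * rate n M0)).
have C0 : 0 < C by rewrite mulr_gt0 ?expR_gt0 ?powR_gt0 ?likelihood_gt0.
have mS : measurable_fun setT S.
  apply: measurable_sum => s; apply: measurableT_comp; first exact: normr_measurable.
  exact: measurable_entry.
have mw := @measurable_student_weight R d1 d2 n%:R^-1.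
have w0 N : 0 <= student_weight n%:R^-1 N by exact: powR_ge0.
have S0 N : 0 <= S N by apply: sumr_ge0.
have meS : measurable_fun setT (fun N => (expR (- (alpha * S N)) * student_weight n%:R^-1 N)%:E).
  apply/measurable_EFinP; apply: measurable_funM => //.
  apply: measurableT_comp; first exact: measurable_expR.
  by apply: measurableT_comp => //; exact: measurable_funM.
have meSw : measurable_fun setT (fun N => (S N * student_weight n%:R^-1 N)%:E).
  by apply/measurable_EFinP; exact: measurable_funM.
have lower : ((expR (- (4 * alpha)) * Z)%:E <=
   \int[@lebesgue_mx R d1.+1 d2.+1]_N (expR (- (alpha * S N)) * student_weight n%:R^-1 N)%:E)%E.
  (* There are n terms, each with first moment at most 4 tau Z where tau = 1 / n. *)
  have SZ : (\int[@lebesgue_mx R d1.+1 d2.+1]_N (S N * student_weight n%:R^-1 N)%:E <= (4 * Z)%:E)%E.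
    under eq_integral do rewrite mulr_suml -sumEFin.
    rewrite ge0_integral_sum //; last 2 first.
    - move=> s; apply/measurable_EFinP; apply: measurable_funM => //.
      by apply: measurableT_comp; [exact: normr_measurable|exact: measurable_entry].
    - by move=> s N _; rewrite lee_fin mulr_ge0.
    apply: (@le_trans _ _ (\sum_(s < n) (4 * n%:R^-1 * Z)%:E)%E).
      by apply: lee_sum => s _; exact: momE.
    rewrite sumEFin sumr_const card_ord -mulr_natr lee_fin le_eqVlt; apply/orP; left.
    by apply/eqP; field; rewrite gt_eqF.
  (* The tangent is taken at 4 alpha, the bound for the mean of alpha [S]. *)
  pose k := expR (- (4 * alpha)).
  have -> : k * Z = k * (1 + 4 * alpha) * Z - k * alpha * (4 * Z) by ring.
  rewrite EFinB leeBlDr //.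
  have mRHS : measurable_fun setT (fun N => (expR (- (alpha * S N)) * student_weight n%:R^-1 N)%:E +
     (k * alpha)%:E * (S N * student_weight n%:R^-1 N)%:E)%E.
    by apply: emeasurable_funD => //; exact: emeasurable_funM.
  apply: (@le_trans _ _ (\int[@lebesgue_mx R d1.+1 d2.+1]_N
    ((expR (- (alpha * S N)) * student_weight n%:R^-1 N)%:E +
     (k * alpha)%:E * (S N * student_weight n%:R^-1 N)%:E))%E).
    rewrite EFinM -ZE -ge0_integralZl; first last.
    - by rewrite lee_fin !mulr_ge0 ?expR_ge0 // addr_ge0 // mulr_ge0 // ltW.
    - by move=> N _; rewrite lee_fin.
    - exact/measurable_EFinP.
    - exact: measurableT.
    apply: ge0_le_integral.
    - exact: measurableT.
    - by move=> N _; rewrite -EFinM lee_fin !mulr_ge0 ?expR_ge0 // addr_ge0 // mulr_ge0 // ltW.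
    - by apply: emeasurable_funM => //; exact/measurable_EFinP.
    - exact: mRHS.
    - move=> N _; rewrite -!EFinM -EFinD lee_fin mulrA -mulrDl ler_wpM2r //.
      by rewrite -mulrA exp_tangent.
  rewrite ge0_integralD; first last.
  - by apply: emeasurable_funM => //; exact: meSw.
  - by move=> N _; rewrite -EFinM lee_fin !mulr_ge0 ?expR_ge0 // ltW.
  - exact: meS.
  - by move=> N _; rewrite lee_fin mulr_ge0 ?expR_ge0.
  - exact: measurableT.
  rewrite leeD2l // ge0_integralZl; first last.
  - by rewrite lee_fin mulr_ge0 ?expR_ge0 // ltW.
  - by move=> N _; rewrite lee_fin mulr_ge0.
  - exact: meSw.
  - exact: measurableT.
  by rewrite [leRHS]EFinM lee_wpmul2l // lee_fin mulr_ge0 ?expR_ge0 // ltW.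
apply: (@le_trans _ _ (C%:E * \int[@lebesgue_mx R d1.+1 d2.+1]_N
    (expR (- (alpha * S N)) * student_weight n%:R^-1 N)%:E)%E).
  apply: le_trans (lee_wpmul2l _ lower); last by rewrite lee_fin ltW.
  rewrite -!EFinM lee_fin opprD expRD /C le_eqVlt; apply/orP; left; apply/eqP; ring.
rewrite -ge0_integralZl; first last.
- by rewrite lee_fin ltW.
- by move=> N _; rewrite lee_fin mulr_ge0 ?expR_ge0.
- exact: meS.
- exact: measurableT.
apply: ge0_le_integral.
- exact: measurableT.
- by move=> N _; rewrite -EFinM lee_fin !mulr_ge0 ?expR_ge0 ?powR_ge0 // ltW.
- exact: emeasurable_funM.
- apply: emeasurable_funM; apply/measurable_EFinP.
    apply: (measurableT_comp (measurable_likelihood_powR _ _)); exact: measurable_addmx.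
  apply: (measurableT_comp mw); exact: measurable_addmx.
- move=> N _; rewrite -!EFinM lee_fin.
  have := student_weight_shift_ge N n0 M00; have := likelihood_addmx_ge z M0 N.
  rewrite [M0 + N]addrC -/(S N) => lN wN.
  have lN' : likelihood z M0 `^ alpha * expR (- (alpha * S N)) <= likelihood z (N + M0) `^ alpha.
    have l0 := ltW (likelihood_gt0 z M0); have l1 := ltW (likelihood_gt0 z (N + M0)).
    rewrite -[alpha * _]mulrC -mulNr expRM -powRM ?expR_ge0 //.
    by apply: ge0_ler_powR lN; rewrite ?nnegrE ?mulr_ge0 ?expR_ge0 // ltW.
  rewrite /C mulrACA [leLHS]mulrACA; apply: le_trans (ler_pM _ _ lN' wN).
  - by rewrite le_eqVlt; apply/orP; left; apply/eqP; ring.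
  - by rewrite mulr_ge0 ?expR_ge0 ?powR_ge0.
  - by rewrite mulr_ge0 ?expR_ge0.
Qed.

End evidence.

(** * Posterior mean of the divergence *)

Section finite_events.
Context {d d' : measure_display} {T : measurableType d} {R : realType}.
Context {T' : measurableType d'} (P : probability T R) (n : nat).
Context (Z : 'I_n -> {RV P >-> T'}).
Hypothesis mT' : forall A : set T', measurable A.

Let cylinder (z : 'I_n -> T') : set T := \bigcap_(i in [set` [set: 'I_n]%SET]) (Z i @^-1` [set z i]).

Let measurable_cylinder z : measurable (cylinder z).
Proof.
apply: fin_bigcap_measurable; first exact: finite_finset.
by move=> i _; rewrite -[X in measurable X]setTI; exact: measurable_funPT.
Qed.

Variables (I : finType) (decode : I -> 'I_n -> T').
Hypothesis decodeP : forall z, exists i, decode i = z.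

Let eventE (F : set ('I_n -> T')) :
  [set t | F (fun s => Z s t)] = \big[setU/set0]_(i | `[< F (decode i) >]) cylinder (decode i).
Proof.
rewrite -(bigcup_pred (fun i => `[< F (decode i) >])); apply/seteqP; split => t /=.
  move=> Ft; have [i iE] := decodeP (fun s => Z s t).
  exists i => /=; first by apply/asboolP; rewrite iE.
  by move=> s _ /=; rewrite iE.
move=> [i /= /asboolP Fi Zi].
rewrite (_ : (fun s => Z s t) = decode i) //.
by apply/funext => s; apply: Zi; rewrite /= finset.in_setT.
Qed.

(** Every event about the sample is a finite union of cylinders, since [decode] reaches all samples.
    This covers events defined through posterior integrals. *)
Lemma measurable_finite_event (F : set ('I_n -> T')) : measurable [set t | F (fun s => Z s t)].
Proof.
rewrite eventE; apply: big_ind => //; first exact: measurableU.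
Qed.

(** Union bound over the cylinders; independence turns the probability of each one into a
    product. *)
Lemma iid_finite_event_le (Q : probability T' R) (F : set ('I_n -> T')) : iid Z Q ->
  (P [set t | F (fun s => Z s t)] <=
   \sum_(i | `[< F (decode i) >]) \prod_(s < n) Q [set decode i s])%E.
Proof.
move=> [Zind Zlaw].
have cylE z : P (cylinder z) = (\prod_(s < n) Q [set z s])%E.
  rewrite /cylinder (Zind [set: 'I_n]%SET (fun s => [set z s])) //.
  by apply: eq_big => [s|s _]; [rewrite finset.in_setT|exact: (Zlaw s [set z s] (mT' _))].
rewrite eventE.
have [//] : measurable (\big[setU/set0]_(i | `[< F (decode i) >]) cylinder (decode i)) /\
  (P (\big[setU/set0]_(i | `[< F (decode i) >]) cylinder (decode i)) <=
   \sum_(i | `[< F (decode i) >]) \prod_(s < n) Q [set decode i s])%E.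
elim/big_rec2 : _ => [|i x A _ [mA PA]]; first by rewrite measure0.
split; first exact: measurableU.
apply: le_trans (measureU2 _ _ _) _ => //; apply: leeD => //.
by rewrite -cylE.
Qed.

End finite_events.

(** * Exponential moment of the divergence and its posterior mean *)

Section renyi_posterior.
Context {R : realType} {d1 d2 : nat}.
Local Notation mat := 'M[R]_(d1.+1, d2.+1).
Local Notation entry := ('I_d1.+1 * 'I_d2.+1)%type.
Local Notation obs := (entry * bool)%type.
Variables (Pi : probability entry R) (alpha : R) (M0 : mat) (n : nat).
Hypotheses (alpha_gt0 : 0 < alpha) (alpha_lt1 : alpha < 1) (n_gt0 : (0 < n)%N).
Variable prior : probability mat R.
Implicit Types (M : mat) (z : 'I_n -> obs).
Local Notation H := (hellinger Pi alpha M0).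

Lemma measurable_hellinger_powR (a : R) : measurable_fun [set: mat] (fun M => H M `^ a).
Proof.
apply: (measurableT_comp (measurable_powR _)).
apply: measurable_sum => o; apply: measurable_funM => //.
apply: measurable_funM => //; apply: (measurableT_comp (measurable_powR _)).
have ml : measurable_fun [set: mat] (fun M => logistic (M o.1.1 o.1.2)).
  by apply: (measurableT_comp measurable_logistic); exact: measurable_entry.
by apply: measurable_funM; apply: measurable_funX => //; exact: measurable_funB.
Qed.

Let powR_prod (a : R) (I : finType) (f : I -> R) : (forall i, 0 <= f i) ->
  (\prod_i f i) `^ a = \prod_i f i `^ a.
Proof.
move=> f0.
suff [] : 0 <= \prod_i f i /\ (\prod_i f i) `^ a = \prod_i f i `^ a by [].
elim/big_rec2 : _ => [|i x y _ [y0 yE]]; first by rewrite powR1.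
by rewrite powRM // yE mulr_ge0.
Qed.

(** This is the expectation over the sample of the prior integral of (L(M) / L(M0))^alpha H(M)^-n:
    the probability of a sample supplies L(M0), which leaves L(M0)^(1 - alpha) L(M)^alpha. The sum
    over samples is taken inside the integral. *)
Lemma sum_weighted_evidence :
  (\sum_(z : {ffun 'I_n -> obs})
     ((\prod_(s < n) entry_mass Pi (z s).1) * likelihood z M0 `^ (1 - alpha))%:E *
     \int[prior]_M (likelihood z M `^ alpha * H M `^ (- n%:R))%:E = 1)%E.
Proof.
have mw (z : {ffun 'I_n -> obs}) : measurable_fun [set: mat]
    (fun M => likelihood z M `^ alpha * H M `^ (- n%:R)).
  by apply: measurable_funM; [exact: measurable_likelihood_powR|exact: measurable_hellinger_powR].
have w0 (z : {ffun 'I_n -> obs}) M : 0 <= likelihood z M `^ alpha * H M `^ (- n%:R).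
  by rewrite mulr_ge0 ?powR_ge0.
have kap0 (z : {ffun 'I_n -> obs}) :
    0 <= (\prod_(s < n) entry_mass Pi (z s).1) * likelihood z M0 `^ (1 - alpha).
  by rewrite mulr_ge0 ?powR_ge0 // prodr_ge0 // => s _; exact: entry_mass_ge0.
transitivity (\int[prior]_M \sum_(z : {ffun 'I_n -> obs})
    (((\prod_(s < n) entry_mass Pi (z s).1) * likelihood z M0 `^ (1 - alpha))%:E *
     (likelihood z M `^ alpha * H M `^ (- n%:R))%:E))%E.
  rewrite ge0_integral_sum //; last 2 first.
  - by move=> z; apply: emeasurable_funM => //; apply/measurable_EFinP; exact: mw.
  - by move=> z M _; rewrite mule_ge0 // lee_fin; [exact: kap0|exact: w0].
  apply: eq_bigr => z _; rewrite ge0_integralZl //.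
  - by apply/measurable_EFinP; exact: mw.
  - by move=> M _; rewrite lee_fin; exact: w0.
  - by rewrite lee_fin; exact: kap0.
rewrite -(probability_setT prior) -[RHS]mul1e -integral_cst //.
apply: eq_integral => M _.
have H0 : 0 < H M by exact: hellinger_gt0.
under eq_bigr do rewrite -EFinM mulrA.
rewrite sumEFin -mulr_suml; congr EFin.
(* For fixed [M] the sum over samples factorises into n equal sums, each of them the Hellinger
   integral. *)
have -> : \sum_(z : {ffun 'I_n -> obs}) (\prod_(s < n) entry_mass Pi (z s).1) *
    likelihood z M0 `^ (1 - alpha) * likelihood z M `^ alpha = H M ^+ n.
  rewrite -[n in RHS]card_ord -prodr_const /hellinger bigA_distr_bigA /=.
  apply: eq_bigr => z _; rewrite !likelihoodE !powR_prod; try by move=> s; exact/ltW/lik_gt0.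
  by rewrite -!big_split /=; apply: eq_bigr => s _; rewrite -mulrA [_ `^ (1 - _) * _]mulrC.
by rewrite powRN powR_mulrn ?(ltW H0) // divff // expf_neq0 // gt_eqF.
Qed.

(** [U M] is n (1 - alpha) times the divergence, and its exponential has posterior mean at most [c].
    The tangent of exp at ln c, U <= ln c - 1 + exp U / c, then bounds the posterior mean of [U] by
    ln c. *)
Lemma posterior_renyi_le z (B c : R) : 0 < B -> 1 <= c ->
  (\int[prior]_M (likelihood z M `^ alpha)%:E = B%:E)%E ->
  (\int[prior]_M (likelihood z M `^ alpha * H M `^ (- n%:R))%:E <= (c * B)%:E)%E ->
  (\int[fractional_posterior alpha prior z]_M
     renyi_divergence (obs_law Pi M) (obs_law Pi M0) alpha <= (ln c / (n%:R * (1 - alpha)))%:E)%E.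
Proof.
move=> B0 c1 BE AB.
have a1 : 0 < 1 - alpha by rewrite subr_gt0.
have nR : 0 < n%:R :> R by rewrite ltr0n.
have c0 : 0 < c by rewrite (lt_le_trans ltr01).
pose k := n%:R * (1 - alpha); have k0 : 0 < k by rewrite mulr_gt0.
have H0 M : 0 < H M by exact: hellinger_gt0.
pose U M : R := - n%:R * ln (H M).
have U0 M : 0 <= U M by rewrite /U mulNr -mulrN mulr_ge0 // oppr_ge0 ln_le0 // hellinger_le1.
have HU M : H M `^ (- n%:R) = expR (U M) by rewrite /powR gt_eqF.
have postE (f : mat -> \bar R) : measurable_fun setT f -> (forall M, 0 <= f M)%E ->
    (\int[fractional_posterior alpha prior z]_M f M =
     (B^-1)%:E * \int[prior]_M (f M * (likelihood z M `^ alpha)%:E))%E.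
  by move=> mf f0; apply: ge0_integral_mnormalize_density.
have mE : measurable_fun setT (fun M => (expR (U M))%:E).
  by under eq_fun do rewrite -HU; apply/measurable_EFinP; exact: measurable_hellinger_powR.
have mU : measurable_fun setT (fun M => (U M)%:E).
  rewrite (_ : (fun _ => _) = fun M => (ln (H M `^ (- n%:R)))%:E).
    apply/measurable_EFinP; apply: measurableT_comp; first exact: measurable_ln.
    exact: measurable_hellinger_powR.
  by apply/funext => M; rewrite HU expRK.
set post := fractional_posterior alpha prior z in postE *.
have int_cst (a : R) : (\int[post]_M a%:E = a%:E)%E.
  apply: (etrans (integral_cst _ measurableT _)).
  by rewrite [X in (_ * X)%E](probability_setT post) mule1.
have -> : (\int[post]_M renyi_divergence (obs_law Pi M) (obs_law Pi M0) alpha =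
    k^-1%:E * \int[post]_M (U M)%:E)%E.
  rewrite -ge0_integralZl //; first last.
  - by rewrite lee_fin invr_ge0 ltW.
  - by move=> M _; rewrite lee_fin.
  apply: eq_integral => M _; rewrite renyi_divergenceE // -EFinM; congr EFin.
  by rewrite /U /k; field; rewrite gt_eqF //= gt_eqF //= lt_eqF // subr_lt0.
rewrite mulrC EFinM lee_wpmul2l //; first by rewrite lee_fin invr_ge0 ltW.
(* Adding 1 to both sides makes the majorant ln c + exp U / c nonnegative, as the integration lemmas
   require. *)
rewrite -(leeD2rE _ _ (_ : 1%:E \is a fin_num)) //.
have -> : (\int[post]_M (U M)%:E + 1%:E = \int[post]_M ((U M)%:E + 1%:E))%E.
  rewrite ge0_integralD //; last by move=> M _; rewrite lee_fin.
  by rewrite int_cst.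
apply: (@le_trans _ _ (\int[post]_M ((ln c)%:E + (c^-1)%:E * (expR (U M))%:E))%E).
  apply: ge0_le_integral => //.
  - by move=> M _; rewrite -EFinD lee_fin addr_ge0.
  - exact: emeasurable_funD.
  - by apply: emeasurable_funD => //; exact: emeasurable_funM.
  - move=> M _; rewrite -EFinM -!EFinD lee_fin -lerBlDl.
    have := expR_ge1Dx (U M - ln c); rewrite expRB lnK ?posrE //; lra.
rewrite ge0_integralD //; first last.
- exact: emeasurable_funM.
- by move=> M _; rewrite mule_ge0 ?lee_fin ?expR_ge0 // invr_ge0 ltW.
- by move=> M _; rewrite lee_fin ln_ge0.
rewrite int_cst leeD2l //.
have ci0 : (0 <= (c^-1)%:E)%E by rewrite lee_fin invr_ge0 ltW.
have eU0 M : setT M -> (0 <= (expR (U M))%:E)%E by rewrite lee_fin expR_ge0.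
rewrite (ge0_integralZl _ measurableT mE eU0 ci0).
rewrite postE //.
have -> : (\int[prior]_M ((expR (U M))%:E * (likelihood z M `^ alpha)%:E) =
    \int[prior]_M (likelihood z M `^ alpha * H M `^ (- n%:R))%:E)%E.
  by apply: eq_integral => M _; rewrite -EFinM HU mulrC.
rewrite lee_pdivrMl // lee_pdivrMl // mule1 -EFinM mulrC.
exact: AB.
Qed.

End renyi_posterior.

(* MathComp world. The matrices have d1.+1 rows and d2.+1 columns. When
   rate n Mstar = 0 the lower bound is -oo, since 0^-1 = +oo in \bar R. *)
Theorem theorem6 (R : realType) (d1 d2 n : nat) (n_gt0 : (0 < n)%N)
    (Pi : probability ('I_d1.+1 * 'I_d2.+1)%type R)
    (Mstar : 'M[R]_(d1.+1, d2.+1))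
    (alpha : R) (alpha_gt0 : 0 < alpha) (alpha_lt1 : alpha < 1)
    (d : measure_display) (T : measurableType d) (P : probability T R)
    (Z : 'I_n -> {RV P >-> (('I_d1.+1 * 'I_d2.+1) * bool)%type})
    (Z_iid : iid Z (obs_law Pi Mstar)) :
  (1 - 2%:E / (n%:R * rate n Mstar)%:E <=
   P [set t | \int[fractional_posterior alpha (student_prior n%:R^-1)
                     (fun s => Z s t)]_M
                renyi_divergence (obs_law Pi M) (obs_law Pi Mstar) alpha
              <= (2 * (alpha + 1) / (1 - alpha) * rate n Mstar)%:E])%E.
Proof.
set x := n%:R * rate n Mstar.
have nR : 0 < n%:R :> R by rewrite ltr0n.
have decodeP (z : 'I_n -> ('I_d1.+1 * 'I_d2.+1) * bool) :
    exists i : {ffun 'I_n -> ('I_d1.+1 * 'I_d2.+1) * bool}, (i : _ -> _) = z.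
  by exists (finfun z); apply/funext => s; rewrite ffunE.
have mT := @measurable_obs_set d1 d2.
set good := (X in P X).
have mgood : measurable good.
  exact: (measurable_finite_event Z mT decodeP (fun z =>
    (\int[fractional_posterior alpha (student_prior n%:R^-1) z]_M
       renyi_divergence (obs_law Pi M) (obs_law Pi Mstar) alpha
     <= (2 * (alpha + 1) / (1 - alpha) * rate n Mstar)%:E)%E)).
have x0 : 0 <= x.
  apply: mulr_ge0 => //; apply: divr_ge0 => //; apply: mulr_ge0; first by rewrite !mulr_ge0.
  apply: ln_ge0; rewrite lerDl; apply: divr_ge0; last exact: sqrtr_ge0.
  by apply: mulr_ge0 => //; exact: sqrtr_ge0.
(* For x <= 2 the lower bound 1 - 2 / x is at most 0; the case x = 0 is separate because of the
   inverse of 0. *)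
have [x2|x2] := leP x 2.
  apply: (@le_trans _ _ 0%E); last exact: measure_ge0.
  have [->|xn0] := eqVneq x 0; first by rewrite inve0 mulry gtr0_sg // mul1e /= leNye.
  have xp : 0 < x by rewrite lt_def xn0.
  by rewrite inver (negbTE xn0) -EFinM -EFinB lee_fin subr_le0 ler_pdivlMr // mul1r.
have xp : 0 < x by apply: lt_trans x2.
have M0 : Mstar != 0.
  apply: contraTneq x2 => M0; rewrite -leNgt /x /rate M0 mxrank0 mulr0 !mul0r mulr0.
  by [].
set prior := student_prior n%:R^-1 : probability 'M[R]_(d1.+1, d2.+1) R.
pose H := hellinger Pi alpha Mstar.
pose A (z : 'I_n -> ('I_d1.+1 * 'I_d2.+1) * bool) := (\int[prior]_M (likelihood z M `^ alpha * H M `^ (- n%:R))%:E)%E.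
(* By [sum_weighted_evidence] the ratio of [A z] to [likelihood z Mstar] to the power alpha has
   expectation 1; Markov's inequality is applied at level [x]. *)
pose bad (z : 'I_n -> ('I_d1.+1 * 'I_d2.+1) * bool) :=
  ((x * likelihood z Mstar `^ alpha)%:E < A z)%E.
pose Bad : set T := [set t | bad (fun s => Z s t)].
have mBad : measurable Bad by exact: (measurable_finite_event Z mT decodeP bad).
have PBad : (P Bad <= (x^-1)%:E)%E.
  apply: le_trans (iid_finite_event_le mT decodeP bad Z_iid) _.
  rewrite -(mule1 (x^-1)%:E) lee_pdivlMl // -[leRHS](sum_weighted_evidence Pi alpha Mstar n prior).
  rewrite ge0_sume_distrr; last first.
    by move=> i _; apply: prode_ge0 => s _; exact: measure_ge0.
  have kap0 (z : {ffun 'I_n -> ('I_d1.+1 * 'I_d2.+1) * bool}) :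
      0 <= \prod_(s < n) entry_mass Pi (z s).1.
    by apply: prodr_ge0 => s _; exact: entry_mass_ge0.
  (* Markov's inequality by hand: in a sum of nonnegative terms equal to 1, only the bad samples are
     kept. *)
  rewrite [leRHS](bigID (fun z : {ffun 'I_n -> ('I_d1.+1 * 'I_d2.+1) * bool} => `[< bad z >])) /=.
  rewrite -[leLHS]adde0; apply: leeD; last first.
    apply: sume_ge0 => z _; apply: mule_ge0; first by rewrite lee_fin mulr_ge0 ?powR_ge0.
    by apply: integral_ge0 => M _; rewrite lee_fin mulr_ge0 ?powR_ge0.
  apply: lee_sum => z /asboolP bz.
  have -> : (\prod_(s < n) obs_law Pi Mstar [set z s] =
      (\prod_(s < n) entry_mass Pi (z s).1 * likelihood z Mstar)%:E)%E.
    rewrite likelihoodE -big_split /= -prodEFin; apply: eq_bigr => s _; exact: obs_law1.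
  have l0 := likelihood_gt0 z Mstar.
  have lE : likelihood z Mstar = likelihood z Mstar `^ (1 - alpha) * likelihood z Mstar `^ alpha.
    by rewrite -powRD ?subrK ?powRr1 ?(ltW l0) // (gt_eqF l0) implybT.
  have -> : (x%:E * (\prod_(s < n) entry_mass Pi (z s).1 * likelihood z Mstar)%:E =
      (\prod_(s < n) entry_mass Pi (z s).1 * likelihood z Mstar `^ (1 - alpha))%:E *
      (x * likelihood z Mstar `^ alpha)%:E)%E.
    by rewrite [in LHS]lE -!EFinM; congr EFin; ring.
  by apply: lee_wpmul2l (ltW bz); rewrite lee_fin mulr_ge0 ?powR_ge0.
have good_of_not_bad : ~` Bad `<=` good.
  move=> t; rewrite /Bad /bad /good /= => /negP; rewrite -leNgt.
  move: (fun s => Z s t) => z Az.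
  have [B B0 [BE Bge]] : exists2 B : R, 0 < B &
      (\int[prior]_M (likelihood z M `^ alpha)%:E = B%:E)%E /\
      likelihood z Mstar `^ alpha * expR (- (x + 4 * alpha)) <= B.
    have Bge := evidence_ge z n_gt0 alpha_gt0 M0; rewrite -/x -/prior in Bge.
    have Ble : (\int[prior]_M (likelihood z M `^ alpha)%:E <= 1)%E.
      apply: (@le_trans _ _ (\int[prior]_M (cst 1%E M))%E).
        apply: ge0_le_integral => //.
        - by move=> M _; rewrite lee_fin powR_ge0.
        - by apply/measurable_EFinP; exact: measurable_likelihood_powR.
        - move=> M _; rewrite lee_fin; apply: (@le_trans _ _ (1 `^ alpha)); last by rewrite powR1.
          by apply: ge0_ler_powR; rewrite ?nnegrE ?(ltW (likelihood_gt0 _ _)) ?likelihood_le1 // ltW.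
      rewrite (integral_cst _ measurableT) [X in (_ * X)%E](probability_setT prior).
      by rewrite mule1.
    have Bfin : (\int[prior]_M (likelihood z M `^ alpha)%:E)%E \is a fin_num.
      rewrite ge0_fin_numE; first exact: le_lt_trans Ble (ltry _).
      by apply: integral_ge0 => M _; rewrite lee_fin powR_ge0.
    have BE := fineK Bfin; move: Bge; rewrite -BE lee_fin => Bge.
    exists (fine (\int[prior]_M (likelihood z M `^ alpha)%:E)%E) => //.
    by apply: lt_le_trans Bge; rewrite mulr_gt0 ?expR_gt0 ?powR_gt0 ?likelihood_gt0.
  (* Origin of the constant: outside [Bad], A z <= x L(Mstar)^alpha <= x exp (x + 4 alpha) B. Here x
     <= exp x, and 4 alpha <= 2 alpha x because x > 2, so the factor of B is at most exp (2 (alpha +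
     1) x). *)
  have c1 : 1 <= expR (2 * (alpha + 1) * x).
    rewrite -expR0 ler_expR; apply: mulr_ge0 => //; apply: mulr_ge0 => //.
    by rewrite addr_ge0 // ltW.
  apply: le_trans (posterior_renyi_le (Pi := Pi) (M0 := Mstar)
    alpha_gt0 alpha_lt1 n_gt0 B0 c1 BE _) _.
    apply: (le_trans Az); rewrite lee_fin.
    apply: le_trans (ler_wpM2l (expR_ge0 _) Bge).
    rewrite mulrCA mulrC ler_pM2l ?powR_gt0 ?likelihood_gt0 // -expRD.
    apply: (@le_trans _ _ (expR x)); first by have := expR_ge1Dx x; lra.
    by rewrite ler_expR; nra.
  rewrite expRK lee_fin /x le_eqVlt; apply/orP; left; apply/eqP; field.
  by rewrite (lt0r_neq0 nR) andbT lt0r_neq0 // subr_gt0.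
apply: (@le_trans _ _ (P (~` Bad))); last first.
  by apply: le_measure => //; rewrite inE //; exact: measurableC.
(* The exceptional event has probability at most 1 / x, half of the permitted 2 / x. *)
rewrite probability_setC // leeB //; apply: (le_trans PBad).
rewrite inver gt_eqF // -EFinM lee_fin ler_peMl ?invr_ge0 ?ler1n // ltW.
Qed.
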